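(* Consider a sequence, indexed by $n\in\mathbb{N}$, of $J$-class GPS systems with basic weight vector $\alpha\in[0,1]^J$ and redistribution weight vector $\beta\in(0,1)^J$ ($\sum_i\alpha_i=\sum_i\beta_i=1$), with cumulative work arrival processes $H^n$, unfinished work processes $U^n$ and busy time processes $T^n$ as described in the context. Suppose: (A) (for every $n$) $U^n(0)\in\mathbb{R}_+^J$; $H^n\in\mathcal{D}([0,\infty):\mathbb{R}_+^J)$ is nondecreasing and piecewise constant with $H^n(0)=0$; and almost surely $H^n$ has finitely many jump points in every finite interval. (B) (law of large numbers) There is $\bar u\in\mathbb{R}_+^J$ with $U^n(0)/n\to\bar u$ a.s.; for each $n$ there is $\gamma^n\in\mathbb{R}_+^J$ such that a.s. $H^n(mt)/m\to\gamma^n t$ as $m\to\infty$, uniformly on compact sets (u.o.c.) in $t$; and there is $\gamma\in\mathbb{R}_+^J$ with $\gamma^n\to\gamma$. (C) (central limit theorem) With $\nu=\gamma-\alpha$ and $\mathcal{M}(\nu)$ as in the context: there is a random variable $\hat u\in\mathcal{M}(\nu)$ such that $U^n(0)/\sqrt n\to\hat u$ a.s.; $\widehat H^n\Rightarrow B$, where $\widehat H^n(t)=\sqrt n\,(H^n(nt)/n-\gamma^n t)$ and $B$ is a driftless $J$-dimensional Brownian motion with covariance matrix $M^H$ (with the convention that the processes are realized on a probability space on which $\widehat H^n\to B$ a.s. u.o.c.); and there is $\hat c\in\mathbb{R}^J$ with $\sqrt n(\gamma^n-\gamma)\to\hat c$. (D) (heavy traffic) $\sum_{i=1}^J\gamma_i=1$.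 Let $\mathcal{S}=\mathcal{S}(\nu)$, $\mathcal{K}=\mathcal{I}\setminus\mathcal{S}$, $\beta_i^{\mathcal K}=\beta_i/\sum_{k\in\mathcal K}\beta_k$ for $i\in\mathcal K$, and let $\overline\Gamma^{\mathcal K}$ be the GPS extended Skorokhod map on index set $\mathcal K$ with weights $\beta^{\mathcal K}=(\beta^{\mathcal K}_i)_{i\in\mathcal K}$. For $i\in\mathcal K$ let $$\widehat X_i^{\mathcal K}(t)=\hat u_i+B_i(t)+\hat c_i t+\beta_i^{\mathcal K}\sum_{j\in\mathcal S}\big(B_j(t)+\hat c_j t\big),\qquad \widehat U^{\mathcal K}=\overline\Gamma^{\mathcal K}(\widehat X^{\mathcal K}),$$ let $\widehat U_i=\widehat U_i^{\mathcal K}$ for $i\in\mathcal K$ and $\widehat U_i=0$ for $i\in\mathcal S$, and let $\widehat T(t)=\hat u+B(t)-\widehat U(t)+\hat c\,t$. Then, as $n\to\infty$, $\widehat U^n\Rightarrow\widehat U$ and $\widehat T^n\Rightarrow\widehat T$.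
   Context: **Notation.** $1<J<\infty$, $\mathcal I=\{1,\dots,J\}$. $\mathcal D([0,\infty):E)$ is the space of $E$-valued right-continuous functions with left limits, with the topology of uniform convergence on compact sets (u.o.c.); $\Rightarrow$ is weak convergence of the induced measures on this space. $\iota(t)=t$. Vector inequalities are componentwise. $|\eta|(t)$ is the total variation of $\eta$ on $[0,t]$. **GPS system.** For $E\subseteq\mathcal I$ put $\alpha_i^{\varnothing}=\alpha_i$, and in general $\alpha_i^E=\alpha_i+\frac{\beta_i}{\sum_{j\notin E}\beta_j}\sum_{j\in E}\alpha_j$ for $i\notin E$, $\alpha_i^E=0$ for $i\in E$. Given $U^n(0)$ and $H^n$ as in (A), the processes $(U^n,I^n_E,E\subseteq\mathcal I)$ are the (unique) solution of $$U_i^n(t)=U_i^n(0)+H_i^n(t)-\sum_{E\subset\mathcal I:\,i\notin E}\alpha_i^E I_E^n(t),\qquad I_E^n(t)=\int_0^t 1_{\{E^n(s)=E\}}ds,\qquad E^n(s)=\{i\in\mathcal I:U_i^n(s)=0\},$$ and the busy time process is $T_i^n=\sum_{E\subset\mathcal I:\,i\notin E}\alpha_i^E I^n_E$. **GPS Skorokhod problem (SP) and extended Skorokhod problem (ESP) on an index set.** Let $A$ be a nonempty finite set with weights $b\in(0,1]^A$, $\sum_{i\in A}b_i=1$; $(e_i)_{i\in A}$ is the standard basis of $\mathbb R^A$. Put $d_i=e_i-\sum_{j\in A\setminus\{i\}}\frac{b_j}{1-b_i}e_j$ for $i\in A$, and $d_*=\sum_{i\in A}e_i/\sqrt{|A|}$.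 For $x\in\mathbb R_+^A$, $d(x)=\{\sum_{i:x_i=0}a_id_i:a_i\ge0\}$ if $x\ne0$, and $d(0)=\{\sum_{i\in A}a_id_i+a_*d_*:a_i,a_*\ge0\}$. Let $\psi\in\mathcal D([0,\infty):\mathbb R^A)$ with $\psi(0)\in\mathbb R^A_+$. - $(\varphi,\eta)$ solves the GPS ESP for $\psi$ if $\varphi(0)=\psi(0)$ and for all $t\ge0$: $\varphi(t)=\psi(t)+\eta(t)$; $\varphi(t)\in\mathbb R_+^A$; for every $s\in[0,t]$, $\eta(t)-\eta(s)\in\overline{\mathrm{co}}[\bigcup_{u\in(s,t]}d(\varphi(u))]$ (closed convex hull); and $\eta(t)-\eta(t-)\in\overline{\mathrm{co}}[d(\varphi(t))]$. It has a unique solution for every such $\psi$; the GPS extended Skorokhod map is $\overline\Gamma(\psi)=\varphi$. - $(\varphi,\eta)$ solves the GPS SP for $\psi$ if $\varphi(0)=\psi(0)$ and for all $t\ge 0$: $\varphi(t)=\psi(t)+\eta(t)$; $\varphi(t)\in\mathbb R_+^A$; $|\eta|(t)<\infty$; $|\eta|(t)=\int_{[0,t]}1_{\{\varphi(s)\in\partial\mathbb R_+^A\}}d|\eta|(s)$; and there is a measurable $g:[0,\infty)\to\mathbb R^A$ with $g(s)\in d(\varphi(s))$, $|g(s)|=1$ for $d|\eta|$-a.e. $s$ and $\eta(t)=\int_{[0,t]}g(s)\,d|\eta|(s)$. The GPS Skorokhod map is $\Gamma(\psi)=\varphi$ (it agrees with $\overline\Gamma(\psi)$ whenever an SP solution exists).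 For $A=\mathcal I$, $b=\beta$ these are written $\Gamma,\overline\Gamma$ and $d_{J+1}:=d_*$. **Projection, strictly subcritical classes, invariant manifold.** (with $A=\mathcal I$, $b=\beta$) The projection $\pi:\mathbb R^J\to\mathbb R_+^J$ is characterized by $\pi(x)=x$ if $x\in\mathbb R_+^J$, and $\pi(x)\in\partial\mathbb R_+^J$, $\pi(x)-x\in d(\pi(x))$ otherwise. For $\nu\in\mathbb R^J$ with $\sum_j\nu_j\ge0$ there is a unique $\theta\in\mathbb R_+^{J+1}$ with $\pi(\nu)=\nu+\sum_{k=1}^{J+1}\theta_kd_k$ and $\mathcal I\ne\{k\in\mathcal I:\theta_k>0\}\subseteq\{k\in\mathcal I:\pi(\nu)_k=0\}$; put $\mathcal S_0(\nu)=\{j\in\mathcal I:\theta_j>0\}$. Define $\mathcal S(\nu)=\mathcal I$ if $\sum_j\nu_j<0$, $\mathcal S(\nu)=\mathcal S_0(\nu)$ if $\sum_j\nu_j\ge0$, and $\mathcal M(\nu)=\{x\in\mathbb R_+^J:x_i=0\text{ for every }i\in\mathcal S(\nu)\}$. **Scalings.** $\overline U^n(t)=U^n(nt)/n$, $\overline T^n(t)=T^n(nt)/n$. Fluid limits: $\overline U=\Gamma(\bar u+\nu\iota)$, $\overline T=\gamma\iota+\bar u-\overline U$. Diffusion scaled processes: $\widehat U^n=\sqrt n(\overline U^n-\overline U)$, $\widehat T^n=\sqrt n(\overline T^n-\overline T)$. *)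

(* Defs.v *)
From HB Require Import structures.
From mathcomp Require Import all_boot all_order all_algebra.
From mathcomp Require Import all_classical all_reals all_analysis.

Set Implicit Arguments.
Unset Strict Implicit.
Unset Printing Implicit Defensive.

Import Order.TTheory GRing.Theory Num.Theory.
Import numFieldNormedType.Exports.

Local Open Scope classical_set_scope.
Local Open Scope ring_scope.

(* Vectors of R^A are functions A -> R, and paths [0, oo) -> R^A are functions
   R -> A -> R of which only the values at nonnegative times are ever used. *)

Section vectors.
Context {R : realType} {A : finType}.
Implicit Types (x v : A -> R).

Definition nonneg_vec x : Prop := forall i, 0 <= x i.

Definition orthant_boundary : set (A -> R) :=
  [set x | nonneg_vec x /\ exists i, x i = 0].

Definition enorm x : R := Num.sqrt (\sum_i x i ^+ 2).

Definition co_closure (S : set (A -> R)) : set (A -> R) :=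
  closure (smallest (@convex_set R (A -> R)) S : set {ptws A -> R}).

Definition vec_measurable : set (set (A -> R)) :=
  <<s [set C | exists i (Y : set R),
        measurable Y /\ C = [set x | Y (x i)]] >>.

End vectors.

Section cadlag_paths.
Context {R : realType} {A : finType}.

Definition cadlag (x : R -> A -> R) : Prop := forall i,
  (forall t, 0 <= t -> x s i @[s --> t^'+] --> x t i) /\
  (forall t, 0 < t -> cvg (x s i @[s --> t^'-])).

Definition left_limit (x : R -> A -> R) (t : R) : A -> R :=
  fun i => lim (x s i @[s --> t^'-]).

Definition total_variation_vec (x : R -> A -> R) (t : R) : \bar R :=
  ereal_sup [set (\sum_(k < size p)
      enorm (fun i => x (nth t (0 :: p) k.+1) i - x (nth t (0 :: p) k) i))%:E
    | p in itv_partition 0 t].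

End cadlag_paths.

Definition time_windows {R : realType} : set (set R) :=
  range (fun T : R => `[0, T]%classic).

Definition uoc_space (R : realType) (A : finType) : topologicalType :=
  {family (@time_windows R), R -> {ptws A -> R}}.

Definition uoc_cvg {R : realType} {A : finType}
    (x_ : nat -> R -> A -> R) (x : R -> A -> R) : Prop :=
  (x_ : nat -> uoc_space R A) @ \oo --> (x : uoc_space R A).

Section weak_convergence.
Context {R : realType} {A : finType}.

(* The sigma-algebra on the space of cadlag paths generated by the coordinate
   projections: the u.o.c. topology is not separable, and its Borel sigma-algebra
   is too large for jump processes to be measurable. *)
Definition path_measurable : set (set (R -> A -> R)) :=
  <<s [set x | cadlag x], [set C | exists t i (Y : set R),
        [/\ 0 <= t, measurable Y & C = [set x | cadlag x /\ Y (x t i)]]] >>.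

Definition path_test_function (f : uoc_space R A -> R) : Prop :=
  [/\ exists M, forall x : R -> A -> R, cadlag x -> `|f x| <= M,
      {within [set x : uoc_space R A | cadlag (x : R -> A -> R)], continuous f}
    & forall Y : set R, measurable Y ->
        path_measurable [set x | cadlag x /\ Y (f x)]].

Context {d : measure_display} {T : measurableType d} (P : probability T R).

Definition cadlag_process (X : T -> R -> A -> R) : Prop :=
  (forall w, cadlag (X w)) /\
  (forall t i, 0 <= t -> measurable_fun setT (fun w => X w t i)).

Definition weak_cvg (X_ : nat -> T -> R -> A -> R) (X : T -> R -> A -> R) :=
  [/\ forall n, cadlag_process (X_ n),
      cadlag_process X
    & forall f, path_test_function f ->
        ('E_P[fun w => f (X_ n w)] @[n --> \oo] --> 'E_P[fun w => f (X w)])%E].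

End weak_convergence.

Section brownian_motion.
Context {R : realType} {J : nat} {d : measure_display} {T : measurableType d}.
Variable P : probability T R.

Definition quadratic_form (M : 'M[R]_J) (xi : 'I_J -> R) : R :=
  \sum_i \sum_j xi i * M i j * xi j.

(* [normal_prob 0 0] is not the degenerate normal law. *)
Definition centered_normal (v : R) : set R -> \bar R :=
  if 0 < v then normal_prob 0 (Num.sqrt v) else \d_(0 : R).

Definition covariance_matrix (M : 'M[R]_J) : Prop :=
  M^T = M /\ forall xi, 0 <= quadratic_form M xi.

Definition increment (B : T -> R -> 'I_J -> R) (s t : R) (w : T) : 'I_J -> R :=
  fun i => B w t i - B w s i.

Definition independent_increments (B : T -> R -> 'I_J -> R) : Prop :=
  forall (m : nat) (t : nat -> R) (Y : nat -> set ('I_J -> R)),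
    0 <= t 0%N -> (forall k, t k <= t k.+1) ->
    (forall k, vec_measurable (Y k)) ->
    P (\bigcap_(k in `I_m) (increment B (t k) (t k.+1) @^-1` Y k)) =
    (\prod_(k < m) P (increment B (t k) (t k.+1) @^-1` Y k))%E.

(* A Gaussian vector of covariance (t - s) M is given by the laws of its linear
   combinations. *)
Definition brownian_motion (M : 'M[R]_J) (B : T -> R -> 'I_J -> R) : Prop :=
  [/\ covariance_matrix M,
      forall t i, 0 <= t -> measurable_fun setT (fun w => B w t i),
      forall w i, B w 0 i = 0 /\
        {within `[0, +oo[, continuous (fun t => B w t i)},
      independent_increments B
    & forall s t (xi : 'I_J -> R) (Y : set R), 0 <= s -> s <= t ->
        measurable Y ->
        P [set w | Y (\sum_i xi i * increment B s t w i)] =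
        centered_normal ((t - s) * quadratic_form M xi) Y].

End brownian_motion.

Section gps_skorokhod.
Context {R : realType} {A : finType}.
Variable b : A -> R.

Definition gps_dir (i : A) : A -> R :=
  fun j => if j == i then 1 else - (b j / (1 - b i)).

Definition gps_dir_star : A -> R := fun _ => (Num.sqrt #|A|%:R)^-1.

Definition gps_comb (a : A -> R) (astar : R) : A -> R :=
  fun j => \sum_i a i * gps_dir i j + astar * gps_dir_star j.

Definition gps_cone (x : A -> R) : set (A -> R) :=
  [set gps_comb a astar | a in [set a | nonneg_vec a /\
                                        forall i, x i != 0 -> a i = 0]
                        & astar in [set astar | 0 <= astar /\
                                        ((exists i, x i != 0) -> astar = 0)]].

(* For s = t the interval (s, t] is empty and there is nothing to require; the
   jump condition at 0 is void since phi 0 = psi 0. *)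
Definition gps_ESP (psi phi eta : R -> A -> R) : Prop :=
  [/\ cadlag phi, phi 0 = psi 0 &
      forall t, 0 <= t ->
      [/\ phi t = (fun i => psi t i + eta t i),
          nonneg_vec (phi t),
          forall s, 0 <= s < t ->
            co_closure (\bigcup_(u in `]s, t]) gps_cone (phi u))
              (fun i => eta t i - eta s i)
        & 0 < t -> co_closure (gps_cone (phi t))
                     (fun i => eta t i - left_limit eta t i)]].

Definition gps_ESM (psi phi : R -> A -> R) : Prop :=
  exists eta, gps_ESP psi phi eta.

(* F is |eta|, extended by 0 to the negative times, as a Stieltjes function. *)
Definition gps_SP (psi phi eta : R -> A -> R) : Prop :=
  [/\ cadlag phi, phi 0 = psi 0,
      forall t, 0 <= t ->
        [/\ phi t = (fun i => psi t i + eta t i), nonneg_vec (phi t)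
          & (total_variation_vec eta t < +oo)%E]
    & exists F : cumulative R R,
      let deta := lebesgue_stieltjes_measure F in
      [/\ forall t, (F t)%:E = if 0 <= t then total_variation_vec eta t else 0%E,
          forall t, 0 <= t -> total_variation_vec eta t =
            (\int[deta]_(s in `[0%R, t])
               (\1_[set s | orthant_boundary (phi s)] s)%:E)%E
        & exists g : R -> A -> R,
          [/\ forall i, measurable_fun (`[0, +oo[%classic : set R) (fun s : R => g s i),
              {ae deta, forall s, 0 <= s ->
                 gps_cone (phi s) (g s) /\ enorm (g s) = 1}
            & forall t i, 0 <= t ->
                eta t i = \int[deta]_(s in `[0, t]) g s i]]].

Definition gps_SM (psi phi : R -> A -> R) : Prop :=
  exists eta, gps_SP psi phi eta.

Definition gps_projection (x p : A -> R) : Prop :=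
  (nonneg_vec x -> p = x) /\
  (~ nonneg_vec x -> orthant_boundary p /\ gps_cone p (fun i => p i - x i)).

Definition strictly_subcritical (nu : A -> R) (S : {set A}) : Prop :=
  (\sum_i nu i < 0 -> S = [set: A]%SET) /\
  (0 <= \sum_i nu i ->
   exists (p th : A -> R) (thstar : R),
     [/\ gps_projection nu p,
         nonneg_vec th /\ 0 <= thstar,
         p = (fun i => nu i + gps_comb th thstar i),
         S = [set j | 0 < th j]%SET
       & S != [set: A]%SET /\ S \subset [set j | p j == 0]%SET]).

End gps_skorokhod.

Definition invariant_manifold {R : realType} {A : finType} (S : {set A}) :
    set (A -> R) :=
  [set x | nonneg_vec x /\ forall i, i \in S -> x i = 0].

Section gps_system.
Context {R : realType} {J : nat}.
Variables alpha beta : 'I_J -> R.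

Definition service_rate (E : {set 'I_J}) (i : 'I_J) : R :=
  if i \in E then 0
  else alpha i + beta i / (\sum_(j | j \notin E) beta j) * \sum_(j in E) alpha j.

Definition empty_classes (U : R -> 'I_J -> R) (s : R) : {set 'I_J} :=
  [set i | U s i == 0]%SET.

Definition empty_time (U : R -> 'I_J -> R) (E : {set 'I_J}) (t : R) : R :=
  \int[lebesgue_measure]_(s in `[0, t]) \1_[set s | empty_classes U s = E] s.

Definition busy_time (U : R -> 'I_J -> R) : R -> 'I_J -> R := fun t i =>
  \sum_(E : {set 'I_J} | i \notin E) service_rate E i * empty_time U E t.

(* Without nonnegativity the equation has spurious solutions, in which an empty
   class keeps being served and its unfinished work becomes negative. *)
Definition gps_workload (U0 : 'I_J -> R) (H U : R -> 'I_J -> R) : Prop :=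
  forall t, 0 <= t ->
    nonneg_vec (U t) /\ forall i, U t i = U0 i + H t i - busy_time U t i.

End gps_system.

Section arrivals.
Context {R : realType} {A : finType}.
Implicit Type h : R -> A -> R.

(* Jump times may still accumulate from the left. *)
Definition piecewise_constant h : Prop := forall t, 0 <= t ->
  exists2 e, 0 < e & forall s, t <= s < t + e -> h s = h t.

Definition jump_times h : set R :=
  [set t | 0 < t /\ exists i, left_limit h t i != h t i].

Definition locally_finite_jumps h : Prop :=
  forall T, finite_set (jump_times h `&` `[0, T]).

Definition arrival_path h : Prop :=
  [/\ cadlag h, forall t, 0 <= t -> nonneg_vec (h t),
      forall s t i, 0 <= s -> s <= t -> h s i <= h t i,
      piecewise_constant h
    & h 0 = (fun=> 0)].

End arrivals.

Section scalings.
Context {R : realType} {A : finType}.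

Definition fluid_scaled (n : nat) (x : R -> A -> R) : R -> A -> R :=
  fun t i => x (n%:R * t) i / n%:R.

Definition diffusion_scaled (n : nat) (x xbar : R -> A -> R) : R -> A -> R :=
  fun t i => Num.sqrt n%:R * (fluid_scaled n x t i - xbar t i).

End scalings.

Definition linear_path {R : realType} {A : finType} (x0 v : A -> R) :
  R -> A -> R := fun t i => x0 i + v i * t.

Section critical_classes.
Context {R : realType} {J : nat}.
Variable S : {set 'I_J}.

Definition critical : finType := {i : 'I_J | i \notin S}.

Definition critical_weight (beta : 'I_J -> R) : critical -> R :=
  fun i => beta (val i) / \sum_(k | k \notin S) beta k.

(* uhat, B and chat are the limits of the initial workloads, of the arrivals and
   of the rates. *)
Definition critical_input (beta uhat chat : 'I_J -> R) (B : R -> 'I_J -> R) :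
    R -> critical -> R := fun t i =>
  uhat (val i) + B t (val i) + chat (val i) * t +
  critical_weight beta i * \sum_(j in S) (B t j + chat j * t).

Definition extend0 (x : R -> critical -> R) : R -> 'I_J -> R :=
  fun t i => oapp (x t) 0 (insub i).

End critical_classes.

(* Main.v *)
(* Every reflection direction of the GPS Skorokhod problem is a positive multiple of
   [e_i - b], so the hulls of direction cones used by the problem have a dual
   description: the increment of the regulator [eta] over a window has nonnegative
   total, has total zero if the path avoids the origin, and if class [i] is busy all
   along then [eta i / b i] increases by no more than any [eta j / b j] ([polar],
   [regulator]).  Two paths with such regulators are as close to each other as their
   inputs: the sum of the regulators is controlled as in the one-dimensional Skorokhod
   problem, and the spread of [(eta i - eta' i) / b i] over [i] decreases whenever it
   is large ([regulated_stability]).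

   The hypotheses force [ubar = 0], hence [Ubar = 0], and the diffusion scaled workload
   has a regulator in this sense, with input [D_n + sqrt n * nu * t] and [D_n]
   converging to a continuous [D].  It is compared with the path which is [UK] on the
   critical classes and zero elsewhere: writing [nu j = beta j * (C - kappa j)] with
   [kappa] positive exactly on the strictly subcritical classes, this path has a
   regulator for the same input up to replacing [D] on the subcritical classes by a
   Lipschitz approximation, as soon as [sqrt n * kappa] dominates the Lipschitz
   constant.  Stability then gives almost sure convergence, uniformly on compact
   sets, and it also makes [UK] a measurable function of the Brownian path. *)
Require Import Defs.
From HB Require Import structures.
From mathcomp Require Import finmap.
From mathcomp Require Import all_boot all_order all_algebra.
From mathcomp Require Import all_classical all_reals all_analysis.
From mathcomp Require Import measurable_realfun ring lra.

Set Implicit Arguments.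
Unset Strict Implicit.
Unset Printing Implicit Defensive.

Import Order.TTheory GRing.Theory Num.Theory.
Import numFieldNormedType.Exports.

Local Open Scope classical_set_scope.
Local Open Scope ring_scope.

(** * Dual description of the reflection cones *)

Lemma cvg_lincomb {R : realType} {A : finType} {X : Type} (F : set_system X)
    (FF : Filter F) (a : A -> R) (f : A -> X -> R) (l : A -> R) :
  (forall i, f i x @[x --> F] --> l i) ->
  \sum_i a i * f i x @[x --> F] --> \sum_i a i * l i.
Proof.
move=> fl; apply: cvg_big => [|i _]; first exact: add_continuous.
by apply: cvgM; [exact: cvg_cst|exact: fl].
Qed.

Section polar.
Context {R : realType} {A : finType}.
Variable b : A -> R.
Implicit Types (v x : A -> R) (Q : set (A -> R)).

(** [Q] is the set of states visited during a time window. All three conditions are linear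
    inequalities in [v], so unlike membership in a cone they pass directly to closed convex hulls
    and to nonnegative combinations. *)
Definition polar Q v : Prop :=
  [/\ 0 <= \sum_i v i,
      (forall x, Q x -> exists i, x i != 0) -> \sum_i v i <= 0
    & forall i, (forall x, Q x -> 0 < x i) -> forall j, v i / b i <= v j / b j].

(** A half-space is convex, so it contains the convex hull of [S]. It is closed for pointwise
    convergence because a finite linear combination of coordinates is continuous, so it contains the
    closure as well. *)
Lemma co_closure_linear_ge0 (S : set (A -> R)) (a v : A -> R) :
  (forall x, S x -> 0 <= \sum_i a i * x i) -> co_closure S v ->
  0 <= \sum_i a i * v i.
Proof.
move=> Sa.
pose l (x : {ptws A -> R}) : R := \sum_i a i * x i.
have lc : continuous l.
  move=> x.
  have projx i : (y i @[y --> (x : {ptws A -> R})]) --> x i.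
    exact: (@proj_continuous A (fun=> R) i x).
  exact (@cvg_lincomb R A {ptws A -> R} (nbhs x) (nbhs_filter x) a (fun i y => y i) x projx).
have hull x : smallest (@convex_set R (A -> R)) S x -> 0 <= l x.
  apply: (@smallest_sub _ _ _ [set y : A -> R | 0 <= l y]) => //.
  move=> y z k; rewrite !inE /= => ly lz.
  have lconv : l (fun i => k%:num * y i + (1 - k%:num) * z i) =
      k%:num * l y + (1 - k%:num) * l z.
    by rewrite /l !mulr_sumr -big_split /=; apply: eq_bigr => i _; ring.
  suff : 0 <= l (fun i => k%:num * y i + (1 - k%:num) * z i) by [].
  by rewrite lconv addr_ge0 // mulr_ge0 // subr_ge0.
move=> cv; rewrite leNgt; apply/negP => lv0.
have nb : nbhs (v : {ptws A -> R}) (l @^-1` [set r | r < 0]).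
  by apply: (lc v); apply: (open_nbhs_nbhs); split => //; exact: open_lt.
by have [x [Sx /=]] := cv _ nb; rewrite ltNge hull.
Qed.

Hypotheses (b_gt0 : forall i, 0 < b i) (b_sum : \sum_i b i = 1).

Lemma weight_le1 i : b i <= 1.
Proof. by rewrite -b_sum (bigD1 i) //= lerDl sumr_ge0 // => j _; exact: ltW. Qed.

Lemma weight_lt1 i j : i != j -> b i < 1.
Proof.
move=> ij; rewrite -b_sum (bigD1 i) //= ltrDl (bigD1 j) 1?eq_sym //=.
by rewrite ltr_wpDr // sumr_ge0 // => k _; exact: ltW.
Qed.

Lemma gps_dir_sum_ge0 i : 0 <= \sum_j gps_dir b i j.
Proof.
rewrite (bigD1 i) //= /gps_dir eqxx.
have := b_sum; rewrite (bigD1 i) //= => bs.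
rewrite (eq_bigr (fun j => - (b j / (1 - b i)))); last by move=> j /negbTE ->.
rewrite sumrN -mulr_suml.
have -> : \sum_(j | j != i) b j = 1 - b i by rewrite -bs addrAC subrr add0r.
(* [1 - b i = 0] is the case of a single class: the quotient takes its default value and the total
   is 1. *)
have [->|ne] := eqVneq (1 - b i) 0; first by rewrite mul0r subr0.
by rewrite divff // subrr.
Qed.

Lemma gps_dir_sum0 i k : i != k -> \sum_j gps_dir b i j = 0.
Proof.
move=> ik; rewrite (bigD1 i) //= /gps_dir eqxx.
have := b_sum; rewrite (bigD1 i) //= => bs.
rewrite (eq_bigr (fun j => - (b j / (1 - b i)))); last by move=> j /negbTE ->.
rewrite sumrN -mulr_suml.
have -> : \sum_(j | j != i) b j = 1 - b i by rewrite -bs addrAC subrr add0r.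
by rewrite divff ?subrr // subr_eq0 gt_eqF // (weight_lt1 ik).
Qed.

Lemma gps_comb_sum a astar : \sum_j gps_comb b a astar j =
  \sum_i a i * \sum_j gps_dir b i j + astar * \sum_(j : A) gps_dir_star j.
Proof.
rewrite /gps_comb big_split /= exchange_big /= mulr_sumr; congr (_ + _).
by apply: eq_bigr => i _; rewrite mulr_sumr.
Qed.

(** Only the directions of empty classes are used, and [gps_dir_star] only at the origin. If class
    [i] is busy, each direction [k] in use has ratio [- 1 / (1 - b k)] to [b] at every coordinate
    other than [k], in particular at [i], and a positive ratio at [k]; so the ratio at [i] is the
    smallest. *)
Lemma gps_cone_polar Q x v : Q x -> gps_cone b x v -> polar Q v.
Proof.
move=> Qx [a [a0 ax]] [astar [astar0 astarx] <-]; split.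
- rewrite gps_comb_sum addr_ge0 //.
    by apply: sumr_ge0 => i _; rewrite mulr_ge0 // gps_dir_sum_ge0.
  by rewrite mulr_ge0 // sumr_ge0 // => i _; rewrite /gps_dir_star invr_ge0 sqrtr_ge0.
- move=> /(_ _ Qx)[k xk]; rewrite gps_comb_sum astarx ?mul0r ?addr0; last by exists k.
  rewrite big1 // => i _; have [->|ik] := eqVneq i k; first by rewrite ax ?mul0r.
  by rewrite (gps_dir_sum0 ik) mulr0.
- move=> i /(_ _ Qx) xi j; rewrite /gps_comb astarx ?mul0r ?addr0; last first.
    by exists i; rewrite gt_eqF.
  rewrite ?mul0r ?addr0 !mulr_suml; apply: ler_sum => k _; rewrite -!mulrA.
  have [ki|ki] := eqVneq k i; first by rewrite ki ax ?mul0r // gt_eqF.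
  apply: ler_wpM2l => //; rewrite /gps_dir eq_sym (negbTE ki).
  have b1 : 0 <= (1 - b k)^-1 by rewrite invr_ge0 subr_ge0 weight_le1.
  rewrite mulNr mulrAC divff ?gt_eqF // mul1r.
  case: eqVneq => [jk|_].
    by rewrite mul1r (@le_trans _ _ 0) // ?oppr_le0 // invr_ge0 ltW.
  by rewrite mulNr mulrAC divff ?gt_eqF // mul1r.
Qed.

(** The three conditions are the nonnegativity of the functionals with coefficients 1, with
    coefficients -1, and [e_j / b j - e_i / b i]; each is checked on the cones and carried to the
    closed hull. *)
Lemma co_closure_polar Q v :
  co_closure (\bigcup_(x in Q) gps_cone b x) v -> polar Q v.
Proof.
move=> cv; have lin := @co_closure_linear_ge0 _ _ _ _ cv.
have cone x : (\bigcup_(y in Q) gps_cone b y) x -> polar Q x.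
  by move=> [y Qy]; exact: gps_cone_polar.
have sum1 (x : A -> R) : \sum_i 1 * x i = \sum_i x i.
  by apply: eq_bigr => i _; rewrite mul1r.
have sumN1 (x : A -> R) : \sum_i -1 * x i = - \sum_i x i.
  by rewrite -sumrN; apply: eq_bigr => i _; rewrite mulN1r.
split.
- have := lin (fun=> 1); rewrite sum1; apply => x /cone[+ _ _].
  by rewrite sum1.
- move=> Qn0; have := lin (fun=> -1); rewrite sumN1 oppr_ge0; apply => x /cone[_ + _].
  by rewrite sumN1 oppr_ge0; apply.
- move=> i Qi j.
  pose a k := (k == j)%:R / b j - (k == i)%:R / b i.
  have aE (x : A -> R) : \sum_k a k * x k = x j / b j - x i / b i.
    have one (l : A) : \sum_k ((k == l)%:R / b l) * x k = x l / b l.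
      rewrite (bigD1 l) //= eqxx big1 ?addr0; first by rewrite mul1r mulrC.
      by move=> k /negbTE ->; rewrite !mul0r.
    by under eq_bigr do rewrite mulrBl; rewrite big_split /= sumrN !one.
  have := lin a; rewrite aE subr_ge0; apply => x /cone[_ _ +].
  by move=> /(_ _ Qi j); rewrite aE subr_ge0.
Qed.

End polar.

(** * Stability of regulated paths *)

Section half_line_continuity.
Context {R : realType}.
Implicit Types (f : R -> R).

(** This replaces the minimum of finitely many positive thresholds: a finite conjunction of
    properties valid for all small [e] is again valid near zero. *)
Lemma near_right0_ex (P : R -> Prop) :
  (\forall e \near 0^'+, P e) -> exists2 e, 0 < e & P e.
Proof.
move=> nP; have : \forall e \near 0^'+, 0 < e /\ P e.
  by near=> e; split; near: e; [exact: nbhs_right_gt|exact: nP].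
by move=> /filter_ex[e [e0 Pe]]; exists e.
Unshelve. all: by end_near. Qed.

Lemma within_half_lineP f : {within `[0, +oo[, continuous f} <->
  forall t, 0 <= t -> forall e, 0 < e ->
    exists2 d, 0 < d & forall s, 0 <= s -> `|s - t| < d -> `|f s - f t| < e.
Proof.
split=> [cf t t0 e e0|cf].
  have /subspace_continuousP/(_ t) := cf; rewrite /= in_itv/= t0 => /(_ isT).
  move=> /cvgrPdist_lt /(_ e e0) /nbhs_ballP[d /= d0 dP].
  exists d => // s s0 sd; rewrite distrC; apply: dP; first by rewrite /ball/= distrC.
  by rewrite /= in_itv/= s0.
apply/subspace_continuousP => t; rewrite /= in_itv/= andbT => t0.
apply/cvgrPdist_lt => e e0; have [d d0 dP] := cf t t0 e e0.
apply/nbhs_ballP; exists d => //= s; rewrite /ball/= distrC => sd.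
by rewrite in_itv/= andbT => s0; rewrite distrC dP.
Qed.

(** The time is the supremum of the times up to [t] at which all [f i] are at most [l]; by
    continuity these inequalities still hold at the supremum. *)
Lemma last_time_below {I : Type} (f : I -> R -> R) (l t : R) :
  (forall i, {within `[0, +oo[, continuous (f i)}) -> 0 <= t ->
  (forall i, f i 0 <= l) -> (exists i, l < f i t) ->
  exists s, [/\ 0 <= s, s < t, forall i, f i s <= l
    & forall u, s < u <= t -> exists i, l < f i u].
Proof.
move=> cf t0 f0 [i0 fi0].
pose E := [set u : R | 0 <= u <= t /\ forall i, f i u <= l].
have hE : has_sup E.
  split; first by exists 0; split; [rewrite lexx|].
  by exists t => u [/andP[]].
have E0 : E 0 by split; [rewrite lexx|].
have s0 : 0 <= sup E by apply: sup_upper_bound.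
have st : sup E <= t by apply: sup_le_ub; [exists 0|move=> u [/andP[]]].
have fs i : f i (sup E) <= l.
  rewrite leNgt; apply/negP => lf.
  have /within_half_lineP/(_ _ s0 (f i (sup E) - l)) := cf i.
  rewrite subr_gt0 => /(_ lf)[d d0 dP].
  have [u Eu su] := sup_adherent d0 hE.
  have us : u <= sup E by apply: sup_upper_bound.
  have [/andP[u0 _] /(_ i) fu] := Eu.
  have := dP u u0; rewrite distrC ger0_norm ?subr_ge0 // => /(_ _).
  rewrite ltrBlDr -ltrBlDl => /(_ su).
  by rewrite ltr_norml => /andP[+ _]; lra.
exists (sup E); split => //.
  rewrite lt_neqAle st andbT; apply/eqP => st'.
  by move: (fs i0); rewrite st' leNgt fi0.
move=> u /andP[su ut]; apply: contrapT => /forallNP h.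
suff : u <= sup E by rewrite leNgt su.
apply: sup_upper_bound => //; split; first by rewrite ut andbT (le_trans s0) // ltW.
by move=> i; rewrite leNgt; apply/negP/h.
Qed.

End half_line_continuity.

Section stability.
Context {R : realType} {A : finType}.
Variable b : A -> R.
Hypotheses (b_gt0 : forall i, 0 < b i) (b_sum : \sum_i b i = 1).
Implicit Types (phi eta psi : R -> A -> R) (T delta t m : R).

(** Keeping only the dual inequalities gives one notion that covers the extended Skorokhod problem,
    the GPS workloads and the comparison path built from the limit. *)
Definition regulator phi eta : Prop := forall s t, 0 <= s -> s < t ->
  polar b (phi @` `]s, t]) (fun i => eta t i - eta s i).

Definition path_continuous (x : R -> A -> R) : Prop :=
  forall i, {within `[0, +oo[, continuous (fun t => x t i)}.

Lemma path_continuous_comb (x y : R -> A -> R) (a c : A -> R) :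
  path_continuous x -> path_continuous y ->
  {within `[0, +oo[, continuous
     (fun t => \sum_i a i * x t i - \sum_i c i * y t i)}.
Proof.
move=> cx cy t; apply: cvgB.
  apply: cvg_big => [|i _]; first exact: add_continuous.
  by apply: cvgM; [exact: cvg_cst|exact: cx].
apply: cvg_big => [|i _]; first exact: add_continuous.
by apply: cvgM; [exact: cvg_cst|exact: cy].
Qed.

(** Continuity is asked of the regulator and not of the path, since workloads jump at arrivals. *)
Definition regulated phi eta : Prop :=
  [/\ forall t : R, 0 <= t -> nonneg_vec (phi t), regulator phi eta
    & path_continuous eta].

(* The input of a path [phi] with regulator [eta] is [phi - eta]. *)
Definition inputs_close T delta phi eta phi' eta' : Prop :=
  (forall i, `|eta 0 i - eta' 0 i| <= delta) /\
  forall (t : R) i, 0 <= t <= T ->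
    `|(phi t i - eta t i) - (phi' t i - eta' t i)| <= delta.

Lemma inputs_closeC T delta phi eta phi' eta' :
  inputs_close T delta phi eta phi' eta' -> inputs_close T delta phi' eta' phi eta.
Proof.
by move=> [z0 zt]; split=> [i|t i tT]; rewrite distrC; [exact: z0|exact: zt].
Qed.

(** One-dimensional Skorokhod argument. After the last time at which the summed difference is within
    the bound, [phi] avoids the origin: at the origin, [phi' >= 0] would force each [eta i - eta' i]
    to be at most [delta]. So the total of [eta] does not increase while that of [eta'] does not
    decrease, and the bound cannot be exceeded. *)
Lemma regulator_sum_le T delta phi eta phi' eta' t :
  regulated phi eta -> regulated phi' eta' ->
  inputs_close T delta phi eta phi' eta' -> 0 <= t <= T ->
  \sum_i (eta t i - eta' t i) <= #|A|%:R * delta.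
Proof.
move=> [_ reg c_eta] [phi'_ge0 reg' c_eta'] [z0 close] /andP[t0 tT].
rewrite leNgt; apply/negP => zt.
have Jd : \sum_(i : A) delta = #|A|%:R * delta by rewrite sumr_const mulr_natl.
pose f (_ : unit) u : R := \sum_i (eta u i - eta' u i).
have cf (i : unit) : {within `[0, +oo[, continuous (f i)}.
  have := @path_continuous_comb _ _ (fun=> 1) (fun=> 1) c_eta c_eta'.
  suff -> : f i = fun u => \sum_i 1 * eta u i - \sum_i 1 * eta' u i by [].
  by apply/funext => u; rewrite /f -sumrB; apply: eq_bigr => k _; rewrite !mul1r.
have f0 (i : unit) : f i 0 <= #|A|%:R * delta.
  by rewrite /f -Jd; apply: ler_sum => k _; rewrite (le_trans (ler_norm _)).
have [|s [s0 st /(_ tt) fs fu]] := last_time_below cf t0 f0; first by exists tt.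
have [_ sumE _] := reg _ _ s0 st; have [sum' _ _] := reg' _ _ s0 st.
have {}sumE : \sum_i eta t i - \sum_i eta s i <= 0.
  rewrite -sumrB; apply: sumE => y [u /=]; rewrite in_itv/= => /andP[su ut] <-.
  apply: contrapT => /forallNP phiu0.
  have u0 : 0 <= u by rewrite (le_trans s0) // ltW.
  have [? +] : exists i, #|A|%:R * delta < f i u by apply: fu; rewrite su ut.
  apply/negP; rewrite -leNgt /f -Jd; apply: ler_sum => i _.
  have : phi u i = 0 by apply/eqP/negPn/negP/phiu0.
  have := close u i; rewrite u0 (le_trans ut) // => /(_ isT).
  have := phi'_ge0 u u0 i; rewrite ler_norml => ? /andP[? ?] ?; lra.
move: sum' fs zt; rewrite /f !sumrB; lra.
Qed.

Lemma weight_bound : exists2 m, 0 < m & forall i, m <= b i.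
Proof.
apply: near_right0_ex; apply: filter_forall => i; exact: nbhs_right_le.
Qed.

(* Comparison of the extreme components: where the spread of the weighted
   difference of the regulators exceeds the bound, the class attaining its maximum
   is busy in the first system and the class attaining its minimum is busy in the
   second one, which makes the spread decrease. *)
Lemma regulator_spread_le m T delta phi eta phi' eta' t i j :
  0 < m -> (forall i, m <= b i) -> 0 < delta ->
  regulated phi eta -> regulated phi' eta' ->
  inputs_close T delta phi eta phi' eta' -> 0 <= t <= T ->
  (eta t i - eta' t i) / b i - (eta t j - eta' t j) / b j
    <= (#|A|%:R + 2) * delta / m ^+ 2.
Proof.
move=> m0 mb delta_gt0 rg rg' cl tT; rewrite leNgt; apply/negP => zt.
have sum_le u : 0 <= u <= T -> `|\sum_i (eta u i - eta' u i)| <= #|A|%:R * delta.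
  move=> uT; rewrite ler_norml (regulator_sum_le rg rg' cl uT) andbT lerNl.
  rewrite -sumrN; under eq_bigr do rewrite opprB.
  exact: (regulator_sum_le rg' rg (inputs_closeC cl) uT).
set l := _ / m ^+ 2 in zt *.
case: rg rg' cl tT => [phi_ge0 reg c_eta] [phi'_ge0 reg' c_eta'] [z0 close] /andP[t0 tT].
pose p u k := (eta u k - eta' u k) / b k.
pose f (k : A * A) u : R := p u k.1 - p u k.2.
have m1 : m <= 1 by rewrite (le_trans (mb i)) // weight_le1.
have lm : l * m ^+ 2 = (#|A|%:R + 2) * delta by rewrite /l divfK // sqrf_eq0 gt_eqF.
have A0 : 0 <= #|A|%:R :> R by [].
have l0 : 0 <= l.
  by rewrite divr_ge0 ?exprn_ge0 ?(ltW m0) // mulr_ge0 ?(ltW delta_gt0) // addr_ge0.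
have cp k : {within `[0, +oo[, continuous (fun u => p u k)}.
  move=> u; apply: cvgM; last exact: cvg_cst.
  by apply: cvgB; [exact: c_eta|exact: c_eta'].
have cf (k : A * A) : {within `[0, +oo[, continuous (f k)}.
  by move=> u; apply: cvgB; exact: cp.
have p0 k : `|p 0 k| <= delta / m.
  rewrite normrM [ `|(b k)^-1|]gtr0_norm ?invr_gt0 // ler_pM ?invr_ge0 //; last first.
    by rewrite lef_pV2 // posrE.
  by rewrite ltW.
have f0 (k : A * A) : f k 0 <= l.
  rewrite (@le_trans _ _ (2 * delta / m)) //.
    have := p0 k.1; have := p0 k.2; rewrite /f !ler_norml => /andP[? ?] /andP[? ?].
    by rewrite -mulrA; lra.
  rewrite ler_pdivrMr // /l expr2 invfM mulrA -[_ / m * m]mulrA mulVf ?mulr1 ?gt_eqF //.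
  rewrite ler_pdivlMr //; nra.
have [|s [s0 st fs fu]] := last_time_below cf t0 f0; first by exists (i, j).
have [d d0 dP] : exists2 d, 0 < d & forall k u, 0 <= u -> `|u - s| < d ->
    `|(eta u k - eta' u k) - (eta s k - eta' s k)| < delta / 4.
  have cz k : {within `[0, +oo[, continuous (fun u => eta u k - eta' u k)}.
    by move=> u; apply: cvgB; [exact: c_eta|exact: c_eta'].
  have d4 : 0 < delta / 4 by rewrite divr_gt0.
  apply: near_right0_ex; apply: filter_forall => k.
  have /within_half_lineP/(_ _ s0 _ d4)[d d0 dP] := cz k.
  near=> e => u u0 us; apply: dP => //; apply: (lt_le_trans us).
  by near: e; exact: nbhs_right_le.
(* The window after [s] is so short that each [eta k - eta' k] varies by less than [delta / 2] on
   it; the classes that are extremal at [v] can then be followed over the whole window. *)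
pose v := Num.min t (s + d / 2).
have sv : s < v by rewrite lt_min st ltrDl divr_gt0.
have vt : v <= t by rewrite ge_min lexx.
have v0 : 0 <= v by rewrite (le_trans s0) // ltW.
have vd : v < s + d by rewrite gt_min ltrD2l (gtr_pMr _ d0) invf_lt1 ?ltr1n ?orbT.
have [[k1 k2] /= fk] : exists k, l < f k v by apply: fu; rewrite sv vt.
have [i1 pi1] : exists i1, forall k, p v k <= p v i1.
  by case: (@arg_maxP _ _ _ i xpredT (p v)) => // i1 _ h; exists i1 => k; exact: h.
have [j1 pj1] : exists j1, forall k, p v j1 <= p v k.
  by case: (@arg_minP _ _ _ i xpredT (p v)) => // j1 _ h; exists j1 => k; exact: h.
have fij : l < p v i1 - p v j1.
  by apply: (lt_le_trans fk); rewrite /f /= lerB.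
have bp k : b k * p v k = eta v k - eta' v k.
  by rewrite /p mulrC divfK // gt_eqF.
have /sum_le : 0 <= v <= T by rewrite v0 (le_trans vt).
rewrite ler_norml -(eq_bigr _ (fun k _ => bp k)) => /andP[sum_lb sum_ub].
(* The [b]-weighted mean of [p v] is the summed difference of the regulators, hence at most
   [#|A| * delta] in absolute value. A gap larger than [l] between the extremes, each of weight at
   least [m], puts the maximum at least [m * l] above the mean and the minimum at least [m * l]
   below it. *)
have hi : - (#|A|%:R * delta) + m * l <= p v i1.
  have : \sum_k b k * p v k <= p v i1 - b j1 * (p v i1 - p v j1).
    rewrite (bigD1 j1) //=.
    have : p v i1 = b j1 * p v i1 + (\sum_(k | k != j1) b k) * p v i1.
      by have := b_sum; rewrite (bigD1 j1) //= -mulrDl => ->; rewrite mul1r.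
    have : \sum_(k | k != j1) b k * p v k <= (\sum_(k | k != j1) b k) * p v i1.
      by rewrite mulr_suml; apply: ler_sum => k _; rewrite ler_wpM2l // ltW.
    lra.
  have : m * l <= b j1 * (p v i1 - p v j1).
    by apply: ler_pM => //; exact: ltW.
  lra.
have lo : p v j1 <= #|A|%:R * delta - m * l.
  have : p v j1 + b i1 * (p v i1 - p v j1) <= \sum_k b k * p v k.
    rewrite (bigD1 i1) //=.
    have : p v j1 = b i1 * p v j1 + (\sum_(k | k != i1) b k) * p v j1.
      by have := b_sum; rewrite (bigD1 i1) //= -mulrDl => ->; rewrite mul1r.
    have : (\sum_(k | k != i1) b k) * p v j1 <= \sum_(k | k != i1) b k * p v k.
      by rewrite mulr_suml; apply: ler_sum => k _; rewrite ler_wpM2l // ltW.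
    lra.
  have : m * l <= b i1 * (p v i1 - p v j1).
    by apply: ler_pM => //; exact: ltW.
  lra.
(* This is what fixes the value of [l]: [m ^+ 2 * l = (#|A| + 2) * delta] and [m <= 1]. *)
have zi : 2 * delta <= eta v i1 - eta' v i1.
  rewrite -bp; apply: (@le_trans _ _ (m * p v i1)); last first.
    rewrite ler_wpM2r // (le_trans _ hi) //; nra.
  nra.
have zj : eta v j1 - eta' v j1 <= - (2 * delta).
  rewrite -bp; apply: (@le_trans _ _ (m * p v j1)); last nra.
  rewrite ler_wnM2r // (le_trans lo) //; nra.
have near_v k u : s < u <= v ->
    `|(eta u k - eta' u k) - (eta v k - eta' v k)| < delta / 2.
  move=> /andP[su uv].
  have := @dP k u; rewrite (le_trans s0) ?ltW // => /(_ isT).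
  rewrite ger0_norm ?subr_ge0 ?ltW // ltrBlDr addrC => /(_ (le_lt_trans uv vd)).
  have := @dP k v; rewrite v0 => /(_ isT).
  rewrite ger0_norm ?subr_ge0 ?ltW // ltrBlDr addrC => /(_ vd).
  by rewrite !ltr_norml => /andP[? ?] /andP[? ?]; apply/andP; split; lra.
have [_ _ /(_ i1) ri] := reg _ _ s0 sv.
have [_ _ /(_ j1) rj] := reg' _ _ s0 sv.
(* Throughout the window [eta i1 - eta' i1] exceeds [delta], while the inputs differ by at most
   [delta]; with [phi' >= 0] this makes [phi] positive at [i1]. *)
have {}ri : (eta v i1 - eta s i1) / b i1 <= (eta v j1 - eta s j1) / b j1.
  apply: ri => y [u /=]; rewrite in_itv/= => suv <-; have := near_v i1 u suv.
  case/andP: suv => su uv; have u0 : 0 <= u by rewrite (le_trans s0) // ltW.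
  have := close u i1; rewrite u0 (le_trans uv) ?(le_trans vt) // => /(_ isT).
  have := phi'_ge0 u u0 i1.
  by rewrite ltr_norml ler_norml => ? /andP[? ?] /andP[? ?]; lra.
have {}rj : (eta' v j1 - eta' s j1) / b j1 <= (eta' v i1 - eta' s i1) / b i1.
  apply: rj => y [u /=]; rewrite in_itv/= => suv <-; have := near_v j1 u suv.
  case/andP: suv => su uv; have u0 : 0 <= u by rewrite (le_trans s0) // ltW.
  have := close u j1; rewrite u0 (le_trans uv) ?(le_trans vt) // => /(_ isT).
  have := phi_ge0 u u0 j1.
  by rewrite ltr_norml ler_norml => ? /andP[? ?] /andP[? ?]; lra.
have := fs (i1, j1); move: fij ri rj; rewrite /f /p /= !mulrBl; lra.
Unshelve. all: by end_near. Qed.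

(** Let [q j] be the weighted difference of the regulators. The spread bound gives
    [q i - L * delta <= q j] for all [j]; averaging with the weights [b j] and using the bound on
    the sum gives [q i <= (L + J) * delta]. The last [delta] is the distance of the inputs. The
    constant depends on the weights alone, not on the horizon or on the paths. *)
Lemma regulated_stability : exists2 C, 0 < C &
  forall (T delta : R) phi eta phi' eta', 0 < delta ->
  regulated phi eta -> regulated phi' eta' ->
  inputs_close T delta phi eta phi' eta' ->
  forall t i, 0 <= t <= T -> `|phi t i - phi' t i| <= C * delta.
Proof.
have [m m0 mb] := weight_bound.
pose J : R := #|A|%:R; pose L := (J + 2) / m ^+ 2.
have J0 : 0 <= J by [].
have L0 : 0 <= L by rewrite divr_ge0 ?exprn_ge0 ?(ltW m0) // addr_ge0.
exists (L + J + 1); first by rewrite ltr_wpDl // addr_ge0.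
have one phi eta phi' eta' T delta t i : 0 < delta ->
    regulated phi eta -> regulated phi' eta' ->
    inputs_close T delta phi eta phi' eta' -> 0 <= t <= T ->
    phi t i - phi' t i <= (L + J + 1) * delta.
  move=> d0 rg rg' cl tT.
  have sp j := regulator_spread_le i j m0 mb d0 rg rg' cl tT.
  have sm := regulator_sum_le rg rg' cl tT.
  have [_ /(_ t i tT)] := cl; rewrite ler_norml => /andP[_ cli].
  pose q j := (eta t j - eta' t j) / b j.
  have bq j : b j * q j = eta t j - eta' t j by rewrite /q mulrC divfK // gt_eqF.
  have ql : q i - L * delta <= J * delta.
    apply: le_trans sm; rewrite -[X in X <= _]mul1r -b_sum mulr_suml.
    apply: ler_sum => j _; rewrite -bq ler_wpM2l ?(ltW (b_gt0 j)) //.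
    have := sp j; rewrite -/(q i) -/(q j) -/J.
    have -> : (J + 2) * delta / m ^+ 2 = L * delta by rewrite /L mulrAC.
    lra.
  have : eta t i - eta' t i <= (L + J) * delta.
    rewrite -bq; have [q0|/ltW q0] := leP 0 (q i).
      rewrite (@le_trans _ _ (q i)) //; first by rewrite ler_piMl // weight_le1.
      by move: ql; lra.
    rewrite (@le_trans _ _ 0) //; last by rewrite mulr_ge0 ?addr_ge0 // ltW.
    by rewrite mulr_ge0_le0 // ltW.
  by lra.
move=> T delta phi eta phi' eta' d0 rg rg' cl t i tT; rewrite ler_norml lerNl opprB.
by rewrite (one _ _ _ _ _ _ _ _ d0 rg rg' cl tT)
  (one _ _ _ _ _ _ _ _ d0 rg' rg (inputs_closeC cl) tT).
Qed.

End stability.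

Section path_continuity.
Context {R : realType} {A : finType}.
Implicit Types (x y : R -> A -> R).

Lemma path_continuous_ext x y :
  (forall t i, 0 <= t -> x t i = y t i) -> path_continuous x -> path_continuous y.
Proof.
move=> xy cx i; apply/within_half_lineP => t t0 e e0.
have /within_half_lineP/(_ t t0 e e0)[d d0 dP] := cx i.
by exists d => // s s0 st; rewrite -!xy ?dP.
Qed.

Lemma path_continuousB x y : path_continuous x -> path_continuous y ->
  path_continuous (fun t i => x t i - y t i).
Proof. by move=> cx cy i t; apply: cvgB; [exact: cx|exact: cy]. Qed.

Lemma path_continuous_cadlag x : path_continuous x -> cadlag x.
Proof.
move=> cx i; have /continuous_within_itvcyP[cx1 cx0] := cx i; split=> t.
  rewrite le_eqVlt => /predU1P[<-//|t0].
  by have /left_right_continuousP[] : {for t, continuous (x ^~ i)}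
    by apply: cx1; rewrite in_itv/= andbT.
move=> t0; apply/cvg_ex; exists (x t i).
by have /left_right_continuousP[] : {for t, continuous (x ^~ i)}
    by apply: cx1; rewrite in_itv/= andbT.
Qed.

Lemma cadlag_path_continuous x : cadlag x ->
  (forall t i, 0 < t -> x s i @[s --> t^'-] --> x t i) -> path_continuous x.
Proof.
move=> cx lx i; have [rx _] := cx i.
apply/continuous_within_itvcyP; split; last exact: rx.
move=> t; rewrite in_itv/= andbT => t0.
by apply/left_right_continuousP; split; [exact: lx|apply: rx; exact: ltW].
Qed.

End path_continuity.

(** * Extended Skorokhod problem with continuous input *)

Section continuous_input.
Context {R : realType} {A : finType}.
Variable b : A -> R.
Hypotheses (b_gt0 : forall i, 0 < b i) (b_sum : \sum_i b i = 1).

(** Here [x] is a left limit and [y] the value after the jump. An empty class satisfies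
    [y i - x i <= 0] because [x i >= 0]. A busy class has the smallest ratio [(y i - x i) / b i],
    which is at most the weighted mean, that is the total, and the total is then at most 0. So no
    coordinate increases, while the total is nonnegative. *)
Lemma polar_jump0 (x y : A -> R) : nonneg_vec x -> nonneg_vec y ->
  polar b [set y] (fun i => y i - x i) -> y = x.
Proof.
move=> x0 y0 [sum_ge0 sum_le0 ord]; apply/funext => k; apply/eqP.
rewrite -subr_eq0; apply/eqP.
have vb i : b i * ((y i - x i) / b i) = y i - x i by rewrite mulrC divfK // gt_eqF.
have v_le0 : forall i, y i - x i <= 0.
  move=> i; have [yi|] := ltP 0 (y i); last first.
    by rewrite le_eqVlt ltNge y0 orbF => /eqP ->; rewrite sub0r oppr_le0.
  have {}sum_le0 : \sum_i (y i - x i) <= 0.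
    by apply: sum_le0 => ? ->; exists i; rewrite gt_eqF.
  have {}ord : forall j, (y i - x i) / b i <= (y j - x j) / b j.
    by apply: ord => ? ->.
  suff : (y i - x i) / b i <= 0 by rewrite pmulr_lle0 // invr_gt0.
  apply: le_trans sum_le0; rewrite -[X in X <= _]mul1r -b_sum mulr_suml.
  by apply: ler_sum => j _; rewrite -[X in _ <= X]vb ler_wpM2l // ltW.
have sum0 : \sum_i - (y i - x i) = 0.
  apply/le_anti; rewrite sumr_ge0 ?andbT; last by move=> i _; rewrite oppr_ge0.
  by rewrite sumrN oppr_le0.
apply/eqP; rewrite -oppr_eq0; apply/eqP.
apply: (@psumr_eq0P _ _ xpredT (fun i => - (y i - x i)) _ sum0) => // i _.
by rewrite oppr_ge0.
Qed.

Lemma ESP_input psi phi eta : gps_ESP b psi phi eta ->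
  (forall t i, 0 <= t -> phi t i - eta t i = psi t i) /\ forall i, eta 0 i = 0.
Proof.
move=> [_ phi0 esp].
have inE t i : 0 <= t -> phi t i - eta t i = psi t i.
  by move=> /esp[-> _ _ _]; rewrite addrK.
by split=> // i; have := inE 0 i (lexx 0); rewrite phi0; lra.
Qed.

(** With continuous input the jumps of [phi] are those of [eta], which lie in the hull of the cone
    at the value after the jump and therefore vanish. The window condition of the problem gives the
    dual inequalities. *)
Lemma ESP_regulated psi phi eta :
  path_continuous psi -> gps_ESP b psi phi eta -> regulated b phi eta.
Proof.
move=> cpsi [cphi phi0 esp].
have etaE t i : 0 <= t -> eta t i = phi t i - psi t i.
  by move=> /esp[-> _ _ _]; rewrite addrC addKr.
have phi_ge0 t : 0 <= t -> nonneg_vec (phi t) by move=> /esp[].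
have lphi t i : 0 < t -> phi s i @[s --> t^'-] --> phi t i.
  move=> t0; pose x := fun i => lim (phi s i @[s --> t^'-]).
  have phix j : phi s j @[s --> t^'-] --> x j by have [_] := cphi j; exact.
  suff /(congr1 (@^~ i)) -> : phi t = x by exact: phix.
  apply: polar_jump0.
  - move=> j; apply: (limr_ge (phix j)).
    by near=> s; apply: phi_ge0; near: s; exact: nbhs_left_ge.
  - exact: phi_ge0 (ltW t0).
  have [_ _ _ /(_ t0)] := esp t (ltW t0).
  rewrite -[gps_cone b _](bigcup_set1 (gps_cone b)) => /(co_closure_polar b_gt0 b_sum).
  congr (polar _ _ _); apply/funext => j; rewrite etaE ?(ltW t0) //.
  suff -> : left_limit eta t j = x j - psi t j by rewrite opprB addrA subrK.
  apply/cvg_lim => //.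
  have : phi s j - psi s j @[s --> t^'-] --> x j - psi t j.
    apply: cvgB; first exact: phix.
    have /continuous_within_itvcyP[+ _] := cpsi j => /(_ t).
    by rewrite in_itv/= andbT => /(_ t0) /left_right_continuousP[].
  apply: cvg_trans; apply: near_eq_cvg; near=> s; rewrite etaE //.
  by near: s; exact: nbhs_left_ge.
split => //.
- move=> s t s0 st; have [_ _ /(_ s) + _] := esp t (ltW (le_lt_trans s0 st)).
  rewrite s0 st => /(_ isT) cl; apply: (co_closure_polar b_gt0 b_sum).
  by rewrite bigcup_image.
- have cphi' := cadlag_path_continuous cphi lphi.
  by apply: path_continuous_ext (path_continuousB cphi' cpsi) => t i /etaE.
Unshelve. all: by end_near. Qed.

End continuous_input.

(** * The fluid limit *)

Section null_reflection.
Context {R : realType}.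

Lemma ae_impl d (T : measurableType d) (mu : {measure set T -> \bar R})
    (P Q : T -> Prop) :
  (forall x, P x -> Q x) -> {ae mu, forall x, P x} -> {ae mu, forall x, Q x}.
Proof. by move=> PQ; apply: filterS. Qed.

Lemma ae_impl3 d (T : measurableType d) (mu : {measure set T -> \bar R})
    (P1 P2 P3 Q : T -> Prop) :
  (forall x, P1 x -> P2 x -> P3 x -> Q x) -> {ae mu, forall x, P1 x} ->
  {ae mu, forall x, P2 x} -> {ae mu, forall x, P3 x} -> {ae mu, forall x, Q x}.
Proof. by move=> PQ; apply: filterS3. Qed.

Lemma ae_bounded_integrable (mu : {measure set (measurableTypeR R) -> \bar R})
    (D : set (measurableTypeR R)) (f : R -> R) (K : R) :
  measurable D -> (mu D < +oo)%E -> measurable_fun D f ->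
  {ae mu, forall x, D x -> `|f x| <= K} -> mu.-integrable D (EFin \o f).
Proof.
move=> mD muD mf fK; apply/integrableP; split; first exact/measurable_EFinP.
apply: (@le_lt_trans _ _ (\int[mu]_(x in D) (Num.max K 0)%:E)%E).
  apply: ae_ge0_le_integral => //.
  - by apply/measurableT_comp => //; exact/measurable_EFinP.
  - by move=> x _; rewrite lee_fin le_max lexx orbT.
  - move: fK; apply: filterS => x fK Dx /=.
    by rewrite lee_fin le_max fK.
by rewrite integral_cst // lte_mul_pinfty // ?lee_fin ?le_max ?lexx ?orbT.
Qed.

(* At every zero of [W] the integral of [h >= 0] vanishes, so [h] is null up to the
   last zero of [W], and it vanishes afterwards because [W] is not zero there. *)
Lemma null_reflection (mu : {measure set (measurableTypeR R) -> \bar R})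
    (h W : R -> R) (K : R) :
  (forall t : R, (mu `[0%R, t]%classic < +oo)%E) ->
  measurable_fun (`[0, +oo[%classic : set (measurableTypeR R)) h ->
  {ae mu, forall s : R, 0 <= s -> [/\ 0 <= h s, h s <= K & W s != 0 -> h s = 0]} ->
  (forall t : R, 0 <= t -> W t = \int[mu]_(s in `[0, t]) h s) -> W 0 = 0 ->
  forall t : R, 0 <= t -> W t = 0.
Proof.
move=> mufin mh hae Wint W0 t t0.
have mD u : measurable (`[0, u]%classic : set (measurableTypeR R)) by [].
have mhu u : measurable_fun (`[0, u]%classic : set (measurableTypeR R)) h.
  apply: measurable_funS mh => //.
  by move=> x /=; rewrite !in_itv/= andbT => /andP[].
have hint u : mu.-integrable `[0, u] (EFin \o h).
  apply: (@ae_bounded_integrable _ _ _ K) => //.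
  apply: ae_impl hae => x hx /=; rewrite in_itv/= => /andP[x0 _].
  by have [? ? _] := hx x0; rewrite ger0_norm.
have null (u : R) : 0 <= u -> W u = 0 -> ae_eq mu `[0, u]%classic (EFin \o h) (cst 0%E).
  move=> u0 Wu; apply/ae_eq_integral_abs => //; first exact/measurable_EFinP.
  transitivity (\int[mu]_(x in `[0%R, u]) (h x)%:E)%E.
    apply: ae_eq_integral => //.
    - by apply/measurableT_comp => //; exact/measurable_EFinP.
    - exact/measurable_EFinP.
    - apply: ae_impl hae => x hx /=; rewrite in_itv/= => /andP[x0 _].
      by have [? ? _] := hx x0; rewrite ger0_norm.
  have Ifin := integrable_fin_num (mD u) (hint u).
  rewrite -[LHS](fineK Ifin); congr (_%:E).
  by rewrite -[RHS]Wu (Wint u u0).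
pose Z := [set s | 0 <= s <= t /\ W s = 0].
have hZ : has_sup Z.
  split; first by exists 0; split; [rewrite lexx|].
  by exists t => u [/andP[]].
(* [W] is not known to be left-continuous, so the supremum of its zeros need not be a zero. Zeros
   approaching it handle the times before it, and the supremum itself is treated separately when it
   is a zero. *)
have /choice[s sZ] : forall k : nat, exists s, Z s /\ sup Z - k.+1%:R^-1 < s.
  move=> k; have k0 : 0 < k.+1%:R^-1 :> R by rewrite invr_gt0.
  by have [s Zs su] := sup_adherent k0 hZ; exists s.
have ae_s : {ae mu, forall x, forall k : nat, 0 <= x <= s k -> h x = 0}.
  apply: ae_foralln => k; have [[/andP[sk0 _] Wsk] _] := sZ k.
  apply: ae_impl (null _ sk0 Wsk) => x hx xs.
  by have /= := hx; rewrite in_itv/= => /(_ xs) [].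
have ae_tau : {ae mu, forall x, W (sup Z) = 0 -> 0 <= x <= sup Z -> h x = 0}.
  have tau0 : 0 <= sup Z by apply: sup_upper_bound => //; split; [rewrite lexx|].
  have [Wtau|] := eqVneq (W (sup Z)) 0; last first.
    by move=> /eqP Wtau; apply: aeW => x /Wtau.
  apply: ae_impl (null _ tau0 Wtau) => x hx _ xs.
  by have /= := hx; rewrite in_itv/= => /(_ xs) [].
have ae_h : ae_eq mu `[0, t]%classic (EFin \o h) (cst 0%E).
  apply: (ae_impl3 _ hae ae_s ae_tau) => x hx hs htau /=.
  rewrite in_itv/= => /andP[x0 xt]; congr (_%:E).
  have [_ _ hW] := hx x0.
  have [xtau|xtau] := ltP x (sup Z); first have xtau0 : 0 < sup Z - x by rewrite subr_gt0.
    have : \forall k \near \oo, k.+1%:R^-1 < sup Z - x.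
      by have := near_infty_natSinv_lt (PosNum xtau0).
    move=> /filter_ex[k xk]; apply: (hs k); rewrite x0 /=.
    have [_ /ltW] := sZ k; apply: le_trans.
    by rewrite lerBrDl -lerBrDr ltW.
  have [Wx|/hW//] := eqVneq (W x) 0.
  have xZ : Z x by split => //; rewrite x0.
  have xle : x <= sup Z by apply: sup_upper_bound.
  have xE : x = sup Z by apply/le_anti; rewrite xle.
  by apply: htau; rewrite -?xE // x0 lexx.
rewrite Wint // /Rintegral (ae_eq_integral (cst 0%E)) ?integral0 //.
exact/measurable_EFinP.
Qed.

Lemma lebesgue_stieltjes_itvcc_lty (F : cumulative R R) (a t : R) :
  (lebesgue_stieltjes_measure F `[a, t]%classic < +oo)%E.
Proof.
(* There may be an atom at [a]; a half-open interval starting earlier contains it and has an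
   explicit finite measure. *)
apply: (@le_lt_trans _ _ (lebesgue_stieltjes_measure F `]a - 1, t]%classic)).
  apply: le_measure; rewrite ?inE //=.
  by move=> x /=; rewrite !in_itv/= => /andP[ax ->]; rewrite andbT ltrBlDr ltr_pwDr.
rewrite /lebesgue_stieltjes_measure/= /measure_extension/=.
rewrite measurable_mu_extE/=; last exact: is_ocitv.
by rewrite wlength_itv/=; case: ifP; rewrite ?ltey // -EFinB ltey.
Qed.

End null_reflection.

Section fluid.
Context {R : realType} {A : finType}.
Variable b : A -> R.
Hypotheses (b_gt0 : forall i, 0 < b i) (b_sum : \sum_i b i = 1).

Lemma enorm_ge_component (x : A -> R) i : `|x i| <= enorm x.
Proof.
rewrite -sqrtr_sqr ler_wsqrtr // (bigD1 i) //= lerDl.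
by apply: sumr_ge0 => j _; exact: sqr_ge0.
Qed.

(** The drift has total zero, so the total [W] of [phi] is the integral of the total [h] of the
    reflection density. This density is nonnegative, bounded by the number of classes, and zero away
    from the origin, that is where [W] is nonzero. *)
Lemma SM_balanced_linear (nu : A -> R) (phi : R -> A -> R) : \sum_i nu i = 0 ->
  gps_SM b (linear_path (fun=> 0) nu) phi ->
  forall (t : R) i, 0 <= t -> phi t i = 0.
Proof.
move=> nu0 [eta [cphi phi0 phiE [F [FE _ [g [mg gae etaE]]]]]] t i t0.
pose h s := \sum_i g s i.
pose W s := \sum_i phi s i.
pose mu : {measure set (measurableTypeR R) -> \bar R} := lebesgue_stieltjes_measure F.
have phi_ge0 s : 0 <= s -> nonneg_vec (phi s) by move=> /phiE[].
suff : W t = 0.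
  by move=> /psumr_eq0P; apply => // j _; exact: phi_ge0.
have g_bound : {ae mu, forall s : R, 0 <= s -> forall j, `|g s j| <= 1}.
  by apply: ae_impl gae => s gs s0 j; have [_ <-] := gs s0; exact: enorm_ge_component.
apply: (@null_reflection _ mu h W #|A|%:R) => //.
- by move=> u; exact: lebesgue_stieltjes_itvcc_lty.
- apply: measurable_sum => j; exact: mg.
- apply: (ae_impl3 _ gae g_bound gae) => s gs gb _ s0.
  have [gc _] := gs s0.
  have [gc1 gc2 _] : polar b [set phi s] (g s) by apply: gps_cone_polar gc.
  split => //.
    rewrite -sum1_card natr_sum; apply: ler_sum => j _.
    by apply: le_trans (gb s0 j); exact: ler_norm.
  move=> Ws; apply/le_anti; rewrite gc1 andbT; apply: gc2 => x ->.
  apply: contrapT => /forallNP phis; move/negP: Ws; apply; apply/eqP.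
  by rewrite /W big1 // => j _; apply/eqP/negPn/negP/phis.
- move=> u u0.
  have gint j : mu.-integrable `[0, u]%classic (EFin \o (fun s => g s j)).
    apply: (@ae_bounded_integrable _ _ _ _ 1) => //.
    + exact: lebesgue_stieltjes_itvcc_lty.
    + apply: measurable_funS (mg j) => // x /=.
      by rewrite !in_itv/= andbT => /andP[].
    + apply: ae_impl g_bound => x gx /=; rewrite in_itv/= => /andP[x0 _]; exact: gx.
  rewrite /Rintegral /h.
  transitivity (fine (\int[mu]_(x in `[0%R, u]) \sum_j (g x j)%:E)%E); last first.
    by congr fine; apply: eq_integral => x _; rewrite sumEFin.
  rewrite integral_sum //.
  have [phiu _ _] := phiE u u0.
  have fin j : (\int[mu]_(x in `[0%R, u]) (g x j)%:E)%E \is a fin_num.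
    exact: integrable_fin_num (gint j).
  transitivity (\sum_j eta u j).
    rewrite /W phiu big_split /= /linear_path.
    under eq_bigr do rewrite add0r.
    by rewrite -mulr_suml nu0 mul0r add0r.
  rewrite (eq_bigr (fun j => (eta u j)%:E)); first by rewrite sumEFin.
  by move=> j _; rewrite etaE // /Rintegral fineK.
- by rewrite /W phi0 big1 // => j _; rewrite /linear_path mulr0 addr0.
Qed.

(* As [gps_dir b i = (e_i - b) / (1 - b i)], this is the decomposition of [- nu] along
   the reflection directions. *)
Lemma strictly_subcritical_rates (nu : A -> R) (S : {set A}) :
  (1 < #|A|)%N -> \sum_i nu i = 0 -> strictly_subcritical b nu S ->
  exists C (kappa : A -> R),
    [/\ forall j, 0 <= kappa j, forall j, (0 < kappa j) = (j \in S),
        forall j, nu j = b j * (C - kappa j) & S != [set: A]%SET].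
Proof.
move=> A1 nu0 [_]; rewrite nu0 => /(_ (lexx _)) [p [th [thstar]]].
move=> [[proj1 proj2] [th0 thstar0] pE SE [SneT _]].
have p_sum0 : nonneg_vec p -> \sum_i p i = 0 -> forall i, p i = 0.
  by move=> p0 /psumr_eq0P ps i; apply: ps => // j _; exact: p0.
have b1 j : b j < 1.
  have [k jk] : exists k, j != k.
    apply: contrapT => /forallNP h; move: A1; rewrite ltnNge => /negP; apply.
    have hj k : k = j by apply/eqP/negPn/negP => kj; apply: (h k); rewrite eq_sym.
    by apply/card_le1_eqP => x y _ _; rewrite (hj x) (hj y).
  exact: weight_lt1 jk.
(* A nonzero projection would receive a reflection of nonpositive total, so its nonnegative
   coordinates would have total zero. *)
have p0 i : p i = 0.
  have [nun|nun] := pselect (nonneg_vec nu).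
    by apply: p_sum0; rewrite proj1.
  have [[pn _] pc] := proj2 nun.
  have [] : polar b [set p] (fun i => p i - nu i) by apply: gps_cone_polar pc.
  rewrite sumrB nu0 subr0 => s0 sp _.
  apply: contrapT => pi0; apply/pi0/p_sum0 => //.
  by apply/le_anti; rewrite s0 andbT; apply: sp => x ->; exists i; apply/eqP.
have dir_sum i : \sum_j gps_dir b i j = 0.
  have [k ik] : exists k, i != k.
    apply: contrapT => /forallNP h; move: (b1 i); rewrite -b_sum (bigD1 i) //=.
    by rewrite big1 ?addr0 ?ltxx // => k ki; case: (h k); rewrite eq_sym.
  exact: gps_dir_sum0 ik.
(* All [gps_dir b i] have total zero, so the total of the decomposition comes from [gps_dir_star]
   alone. *)
have thstarE : thstar = 0.
  have : \sum_i p i = 0 by rewrite big1.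
  rewrite pE big_split /= nu0 gps_comb_sum big1 ?add0r; last by move=> i _; rewrite dir_sum mulr0.
  move=> /eqP; rewrite mulf_eq0 => /orP[/eqP//|]; rewrite gt_eqF //.
  have A0 := ltnW A1.
  by rewrite /gps_dir_star sumr_const pmulrn_lgt0 // invr_gt0 sqrtr_gt0 ltr0n.
exists (\sum_i th i / (1 - b i)), (fun j => th j * ((b j)^-1 + (1 - b j)^-1)).
have k0 j : 0 < (b j)^-1 + (1 - b j)^-1 by rewrite addr_gt0 // invr_gt0 // subr_gt0.
split => //.
- by move=> j; rewrite mulr_ge0 // ltW.
- by move=> j; rewrite SE inE pmulr_lgt0.
- move=> j; have /eqP := p0 j; rewrite pE thstarE /gps_comb mul0r addr0 addr_eq0 => /eqP ->.
  rewrite (bigD1 j) //= [in RHS](bigD1 j) //= /gps_dir eqxx.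
  rewrite (eq_bigr (fun k => - (b j * (th k / (1 - b k))))); last first.
    by move=> k kj; rewrite eq_sym (negbTE kj) mulrN; congr (- _); ring.
  rewrite sumrN -mulr_sumr; field.
  by rewrite subr_eq0 !gt_eqF.
Qed.

End fluid.

(** * Workloads of GPS systems *)

Section right_continuous.
Context {R : realType}.

(** [f] is the pointwise limit of functions constant on the cells of a grid of step [1 / (n + 1)].
    The value is taken at the right end of the cell, strictly to the right of the time considered,
    so that right limits apply. *)
Lemma right_continuous_measurable (f : R -> R) :
  (forall t : R, 0 <= t -> f s @[s --> t^'+] --> f t) ->
  measurable_fun (`[0, +oo[%classic : set R) f.
Proof.
move=> rcf.
pose k (n : nat) (s : R) := Num.truncn (n.+1%:R * s).
pose fn n (s : R) : R := f ((k n s).+1%:R / n.+1%:R).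
apply: (@measurable_fun_cvg _ _ _ _ fn).
  move=> n _ Y mY.
  have -> : `[0, +oo[%classic `&` fn n @^-1` Y =
      \bigcup_(m in [set m : nat | Y (f (m.+1%:R / n.+1%:R))])
        `[m%:R / n.+1%:R, m.+1%:R / n.+1%:R[%classic.
    apply/seteqP; split => s /=.
      rewrite in_itv/= andbT => -[s0 Ys]; exists (k n s) => //=.
      have /truncn_itv : 0 <= n.+1%:R * s by rewrite mulr_ge0.
      by rewrite in_itv/= ler_pdivrMr // ltr_pdivlMr // ![s * _]mulrC.
    move=> [m /= Ym]; rewrite !in_itv/= ler_pdivrMr // ltr_pdivlMr // ![s * _]mulrC andbT.
    move=> ms.
    have s0 : 0 <= s.
      have : 0 <= n.+1%:R * s by case/andP: ms => + _; apply: le_trans.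
      by rewrite pmulr_rge0.
    split => //; suff -> : fn n s = f (m.+1%:R / n.+1%:R) by [].
    rewrite /fn; suff -> : k n s = m by [].
    by apply/eqP; rewrite /k truncn_eq // mulr_ge0.
  by apply: bigcup_measurable => m _; exact: measurable_itv.
move=> s /=; rewrite in_itv/= andbT => s0.
have bounds n : s < (k n s).+1%:R / n.+1%:R <= s + n.+1%:R^-1.
  have /truncn_itv : 0 <= n.+1%:R * s by rewrite mulr_ge0.
  rewrite -/(k n s) => /andP[k1 k2]; rewrite ltr_pdivlMr // [s * _]mulrC k2 /=.
  by rewrite ler_pdivrMr // mulrDl mulVf // -natr1 lerD2r [s * _]mulrC.
apply/cvgrPdist_lt => e e0.
have /cvgrPdist_lt/(_ e e0)[d /= d0 dP] := rcf s s0.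
near=> n; apply: dP => /=; last by case/andP: (bounds n).
have /andP[b1 b2] := bounds n.
rewrite distrC ger0_norm ?subr_ge0 ?(ltW b1) // ltrBlDl (le_lt_trans b2) // ltrD2l.
by near: n; exact: (near_infty_natSinv_lt (PosNum d0)).
Unshelve. all: by end_near. Qed.

End right_continuous.

(** * Occupation times of the sets of empty classes *)

Section occupation.
Context {R : realType} {J : nat}.
Variable U : R -> 'I_J -> R.
Hypothesis cU : cadlag U.

(** The restriction to nonnegative times secures measurability, since the path is arbitrary at
    negative times. *)
Let Z (E : {set 'I_J}) : set R := [set s | 0 <= s /\ empty_classes U s = E].

Let measurable_Z E : measurable (Z E).
Proof.
have -> : Z E = \bigcap_(i in [set: 'I_J])
    (`[0, +oo[%classic `&` [set s | (U s i == 0) = (i \in E)]) `&` `[0, +oo[%classic.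
  apply/seteqP; split => s /=.
    move=> [s0 sE]; rewrite in_itv/= s0; split => // i _; split => //=.
    by rewrite in_itv/= s0.
    by rewrite -sE inE.
  rewrite in_itv/= andbT => -[h s0]; split => //.
  by apply/setP => i; rewrite inE; have [] := h i.
apply: measurableI; last exact: measurable_itv.
apply: fin_bigcap_measurable => [|i _]; first exact: finite_finset.
have mU : measurable_fun (`[0, +oo[%classic : set R) (fun s => U s i).
  by apply: right_continuous_measurable => t; have [+ _] := cU i; exact.
have m0 : measurable (`[0, +oo[%classic `&` [set s : R | U s i = 0]).
  exact: (mU (measurable_itv _) [set 0] (measurable_set1 _)).
have [iE|iE] := boolP (i \in E).
  suff -> : [set s : R | (U s i == 0) = true] = [set s | U s i = 0] by [].
  by apply/seteqP; split => s /= /eqP.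
have -> : `[0, +oo[%classic `&` [set s : R | (U s i == 0) = false] =
    `[0, +oo[%classic `&` (fun s => U s i) @^-1` (~` [set 0]).
  apply/seteqP; split => s /= [s0 h]; split => //; first exact/eqP/negbT.
  by apply/negbTE/eqP.
exact: (mU (measurable_itv _) (~` [set 0]) (measurableC (measurable_set1 _))).
Qed.

Let measurable_ZI E (i : interval R) : measurable (Z E `&` [set` i]).
Proof. by apply: measurableI; [exact: measurable_Z|exact: measurable_itv]. Qed.

Definition occupation (E : {set 'I_J}) (s t : R) : R :=
  fine (lebesgue_measure (Z E `&` `]s, t]%classic)).

Let occ_lty E (i : interval R) (a c : R) : [set` i] `<=` `[a, c]%classic ->
  (lebesgue_measure (Z E `&` [set` i]) < +oo)%E.
Proof.
move=> iac; apply: (@le_lt_trans _ _ (lebesgue_measure `[a, c]%classic)).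
  apply: le_measure; rewrite ?inE //; first exact: measurable_ZI.
  by move=> x [_ /iac].
by rewrite lebesgue_measure_itv/=; case: ifP; rewrite ?ltey // -EFinB ltey.
Qed.

Lemma occupation_ge0 E s t : 0 <= occupation E s t.
Proof. by rewrite fine_ge0. Qed.

Lemma occupation_le E s t : s <= t -> occupation E s t <= t - s.
Proof.
move=> st; rewrite -lee_fin fineK; last first.
  by rewrite ge0_fin_numE //; apply: (@occ_lty _ _ s t); exact: subset_itv_oc_cc.
apply: (@le_trans _ _ (lebesgue_measure `]s, t]%classic)).
  by apply: le_measure; rewrite ?inE //; exact: measurable_ZI.
rewrite lebesgue_measure_itv/=; case: ifP => [_|]; first by rewrite -EFinB.
by rewrite lee_fin subr_ge0.
Qed.

Lemma occupation_eq0 E s t : 0 <= s ->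
  (forall u, s < u <= t -> empty_classes U u != E) -> occupation E s t = 0.
Proof.
move=> s0 h; rewrite /occupation (_ : Z E `&` _ = set0) ?measure0 //.
apply/seteqP; split => // u /= [[_ uE]]; rewrite in_itv/= => sut.
by have := h u sut; rewrite uE eqxx.
Qed.

Lemma empty_timeE E t : 0 <= t ->
  empty_time U E t = fine (lebesgue_measure (Z E `&` `[0, t]%classic)).
Proof.
move=> t0; rewrite /empty_time /Rintegral -integral_indic //; last exact: measurable_Z.
congr fine; apply: eq_integral => s; rewrite inE/= in_itv/= => /andP[s0 _].
rewrite !indicE; congr (_%:R%:E); congr (nat_of_bool _).
by apply/idP/idP; rewrite !inE /Z/= => //; case.
Qed.

Lemma empty_timeB E s t : 0 <= s -> s < t ->
  empty_time U E t - empty_time U E s = occupation E s t.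
Proof.
move=> s0 st; have t0 := ltW (le_lt_trans s0 st).
rewrite !empty_timeE // /occupation.
have -> : Z E `&` `[0, t]%classic =
    (Z E `&` `[0, s]%classic) `|` (Z E `&` `]s, t]%classic).
  rewrite -setIUr; congr (_ `&` _); apply/seteqP; split => u /=; rewrite !in_itv/=.
    by move=> /andP[u0 ut]; have [us|us] := leP u s; [left|right]; rewrite ?u0 ?us ?ut.
  move=> [/andP[-> us]|/andP[su ->]] /=; first by rewrite (le_trans us) // ltW.
  by rewrite andbT (le_trans s0) // ltW.
rewrite measureU; [|exact: measurable_ZI|exact: measurable_ZI|]; last first.
  apply/seteqP; split => // u /=; rewrite !in_itv/= => -[[_ /andP[_ us]] [_ /andP[su _]]].
  by move: su; rewrite ltNge us.
rewrite fineD ?ge0_fin_numE //; first by rewrite addrC addKr.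
  by apply: (@occ_lty _ _ 0 s).
by apply: (@occ_lty _ _ s t); exact: subset_itv_oc_cc.
Qed.

Lemma occupation_sum s t : 0 <= s -> s < t -> \sum_E occupation E s t = t - s.
Proof.
move=> s0 st; apply: EFin_inj; rewrite -sumEFin.
transitivity (\sum_E \int[lebesgue_measure]_(x in `]s, t]) (\1_(Z E) x)%:E)%E.
  apply: eq_bigr => E _; rewrite integral_indic //; last exact: measurable_Z.
  rewrite /occupation fineK // ge0_fin_numE //.
  by apply: (@occ_lty _ _ s t); exact: subset_itv_oc_cc.
rewrite -ge0_integral_sum //.
- transitivity (\int[lebesgue_measure]_(x in `]s, t]) 1)%E.
    apply: eq_integral => x; rewrite inE/= in_itv/= => /andP[sx _].
    rewrite sumEFin (bigD1 (empty_classes U x)) //= big1 ?addr0.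
      by rewrite indicE mem_set //=; split => //; rewrite (le_trans s0) // ltW.
    move=> E /negbTE Ex; rewrite indicE memNset //=; move=> [_ xE].
    by move: Ex; rewrite xE eqxx.
  by rewrite integral_cst //= mul1e lebesgue_measure_itv/= lte_fin st -EFinB.
- by move=> E; apply/measurable_EFinP; apply: measurable_indic; exact: measurable_Z.
Qed.

End occupation.

Section polar_operations.
Context {R : realType} {A : finType}.
Variable b : A -> R.
Implicit Types (phi eta : R -> A -> R).

(** In the application [c E] is the time spent with empty set [E] during a window. The condition is
    asked where [c E] is nonzero, because only such an [E] is known to be realised at some time of
    the window. *)
Lemma polar_lincomb {I : finType} (Q : set (A -> R)) (c : I -> R)
    (v : I -> A -> R) : (forall E, 0 <= c E) ->
  (forall E, c E != 0 -> polar b Q (v E)) ->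
  polar b Q (fun i => \sum_E c E * v E i).
Proof.
move=> c0 vQ.
have sumE : \sum_i \sum_E c E * v E i = \sum_E c E * \sum_i v E i.
  by rewrite exchange_big /=; apply: eq_bigr => E _; rewrite mulr_sumr.
split.
- rewrite sumE; apply: sumr_ge0 => E _.
  have [->|/vQ[? _ _]] := eqVneq (c E) 0; first by rewrite mul0r.
  exact: mulr_ge0.
- move=> Q0; rewrite sumE; apply: sumr_le0 => E _.
  have [->|/vQ[_ /(_ Q0) ? _]] := eqVneq (c E) 0; first by rewrite mul0r.
  exact: mulr_ge0_le0.
- move=> i Qi j; rewrite !mulr_suml; apply: ler_sum => E _; rewrite -!mulrA.
  have [->|/vQ[_ _ /(_ i Qi j) ?]] := eqVneq (c E) 0; first by rewrite !mul0r.
  exact: ler_wpM2l.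
Qed.

(** Applied with [a = n] and [c = sqrt n / n] to pass to the diffusion scale. *)
Lemma regulated_scale (a c : R) phi eta : 0 < a -> 0 < c ->
  regulated b phi eta ->
  regulated b (fun t i => c * phi (a * t) i) (fun t i => c * eta (a * t) i).
Proof.
move=> a0 c0 [phi0 reg ceta]; split.
- by move=> t t0 i; rewrite mulr_ge0 ?(ltW c0) // phi0 // mulr_ge0 // ltW.
- move=> s t s0 st.
  have as0 : 0 <= a * s by rewrite mulr_ge0 // ltW.
  have ast : a * s < a * t by rewrite ltr_pM2l.
  have [sum0 sum1 ord] := reg _ _ as0 ast.
  have win u : a * s < u <= a * t -> s < u / a <= t.
    by rewrite ltr_pdivlMr // ler_pdivrMr // ![_ * a]mulrC.
  have uE u : a * (u / a) = u by rewrite mulrC divfK // gt_eqF.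
  split.
  + by under eq_bigr do rewrite -mulrBr; rewrite -mulr_sumr mulr_ge0 // ltW.
  + move=> h; under eq_bigr do rewrite -mulrBr; rewrite -mulr_sumr mulr_ge0_le0 ?(ltW c0) //.
    apply: sum1 => x [u /=]; rewrite in_itv/= => /win su <-.
    have [|i] := h (fun i => c * phi u i).
      by exists (u / a); rewrite /= ?in_itv/= ?uE.
    by rewrite mulf_eq0 negb_or => /andP[_ ?]; exists i.
  + move=> i h j; rewrite -!mulrBr -!mulrA ler_pM2l //; apply: ord => x [u /=].
    rewrite in_itv/= => /win su <-.
    have := h (fun i => c * phi u i); rewrite pmulr_rgt0 //; apply.
    by exists (u / a); rewrite /= ?in_itv/= ?uE.
- move=> i; apply/within_half_lineP => t t0 e e0.
  have ec : 0 < e / c by rewrite divr_gt0.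
  have at0 : 0 <= a * t by rewrite mulr_ge0 // ltW.
  have /within_half_lineP/(_ _ at0 _ ec)[d d0 dP] := ceta i.
  exists (d / a); first by rewrite divr_gt0.
  move=> s s0; rewrite ltr_pdivlMr // => st.
  rewrite -mulrBr normrM gtr0_norm // mulrC -ltr_pdivlMr //; apply: dP.
    by rewrite mulr_ge0 // ltW.
  by rewrite -mulrBr normrM gtr0_norm // mulrC.
Qed.

End polar_operations.

(** * The GPS workload as a regulated path *)

Section prelimit.
Context {R : realType} {J : nat}.
Variables alpha beta : 'I_J -> R.
Hypotheses (alpha_ge0 : forall i, 0 <= alpha i)
  (beta_gt0 : forall i, 0 < beta i).

(** An empty class gives up its whole share [alpha i], and each busy class receives [beta i * r] of
    what is given up. The total is zero as long as some class is busy, and busy classes share the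
    ratio [- r], below the nonnegative ratios of the empty ones. *)
Lemma service_polar (Q : set ('I_J -> R)) (x : 'I_J -> R) : nonneg_vec x -> Q x ->
  polar beta Q (fun i => alpha i - service_rate alpha beta [set i | x i == 0]%SET i).
Proof.
move=> x0 Qx; set E := [set i | x i == 0]%SET.
pose r := (\sum_(j in E) alpha j) / \sum_(j | j \notin E) beta j.
have vE i : alpha i - service_rate alpha beta E i =
    if i \in E then alpha i else - (beta i * r).
  rewrite /service_rate; case: ifP => _; first by rewrite subr0.
  by rewrite opprD addrA subrr sub0r /r; congr (- _); ring.
have aE0 : 0 <= \sum_(j in E) alpha j by exact: sumr_ge0.
have r0 : 0 <= r.
  by rewrite divr_ge0 //; apply: sumr_ge0 => j _; exact: ltW.
have sumE : \sum_i (alpha i - service_rate alpha beta E i) =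
    \sum_(j in E) alpha j - (\sum_(j | j \notin E) beta j) * r.
  rewrite (bigID (mem E)) /=; congr (_ + _).
    by apply: eq_bigr => i iE; rewrite vE iE.
  rewrite mulr_suml -sumrN; apply: eq_bigr => i iE.
  by rewrite vE (negbTE iE).
have sum0 : (exists i, i \notin E) ->
    \sum_i (alpha i - service_rate alpha beta E i) = 0.
  move=> [i iE]; rewrite sumE mulrC divfK ?subrr // gt_eqF // (bigD1 i) //=.
  by rewrite ltr_pwDl // sumr_ge0 // => j _; exact: ltW.
split.
- have [/existsP/sum0->//|] := boolP [exists i, i \notin E].
  rewrite negb_exists => /forallP allE.
  rewrite sumE [X in _ - X * _]big1 ?mul0r ?subr0 // => i iE.
  by have := allE i; rewrite iE.
- move=> /(_ _ Qx)[i xi]; rewrite sum0 //.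
  by exists i; rewrite inE.
- move=> i /(_ _ Qx) xi j.
  have iE : (i \in E) = false by rewrite inE gt_eqF.
  have rE k : - (beta k * r) / beta k = - r.
    by rewrite mulNr mulrAC divff ?mul1r // gt_eqF.
  rewrite !vE iE rE; case: ifP => _; last by rewrite rE.
  by rewrite (@le_trans _ _ 0) ?oppr_le0 // divr_ge0 // ltW.
Qed.

Variables (U H : R -> 'I_J -> R) (U0 : 'I_J -> R).
Hypotheses (cU : cadlag U) (wU : gps_workload alpha beta U0 H U).

(** This is the regulator of the workload, whose input is [U0 i + H t i - alpha i * t]. *)
Definition redistributed_service (t : R) (i : 'I_J) : R :=
  alpha i * t - busy_time alpha beta U t i.

Lemma redistributed_serviceB s t i : 0 <= s -> s < t ->
  redistributed_service t i - redistributed_service s i =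
  \sum_E occupation U E s t * (alpha i - service_rate alpha beta E i).
Proof.
move=> s0 st.
have busyB : busy_time alpha beta U t i - busy_time alpha beta U s i =
    \sum_E occupation U E s t * service_rate alpha beta E i.
  rewrite /busy_time -sumrB big_mkcond; apply: eq_bigr => E _ /=.
  rewrite -mulrBr empty_timeB // mulrC; case: ifP => // /negbFE iE.
  by rewrite /service_rate iE mulr0.
under eq_bigr do rewrite mulrBr.
rewrite big_split /= sumrN -busyB -mulr_suml (occupation_sum cU s0 st).
by rewrite /redistributed_service; ring.
Qed.

Lemma redistributed_service_lipschitz i : exists2 K, 0 <= K &
  forall s t, 0 <= s -> s < t ->
  `|redistributed_service t i - redistributed_service s i| <= K * (t - s).
Proof.
exists (\sum_E `|alpha i - service_rate alpha beta E i|); first exact: sumr_ge0.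
move=> s t s0 st; rewrite redistributed_serviceB // (le_trans (ler_norm_sum _ _ _)) //.
rewrite mulr_suml; apply: ler_sum => E _; rewrite normrM mulrC ler_wpM2l //.
by rewrite ger0_norm ?occupation_ge0 // occupation_le // ltW.
Qed.

(** The increment over a window is the combination of the rates [alpha - service_rate alpha beta E],
    weighted by the occupation times of the sets [E] visited there. Continuity holds because the
    rates are bounded. *)
Lemma workload_regulated : regulated beta U redistributed_service.
Proof.
split.
- by move=> t /wU[].
- move=> s t s0 st.
  have := @polar_lincomb _ _ beta _ (U @` `]s, t]) (occupation U ^~ s ^~ t)
    (fun E i => alpha i - service_rate alpha beta E i) => h.
  suff : polar beta (U @` `]s, t]) (fun i =>
      \sum_E occupation U E s t * (alpha i - service_rate alpha beta E i)).
    congr (polar _ _ _); apply/funext => i; rewrite redistributed_serviceB //.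
  apply: h => [E|E occ0]; first exact: occupation_ge0.
  have [u sut uE] : exists2 u, s < u <= t & empty_classes U u = E.
    apply: contrapT => h; move/negP: occ0; apply; apply/eqP/occupation_eq0 => // u sut.
    by apply/negP => /eqP uE; apply: h; exists u.
  have u0 : 0 <= u by case/andP: sut => su _; rewrite (le_trans s0) // ltW.
  rewrite -uE; apply: service_polar; first by have [] := wU u0.
  by exists u; rewrite //= in_itv.
- move=> i; apply/within_half_lineP => t t0 e e0.
  have [K K0 KP] := redistributed_service_lipschitz i.
  have K1 : 0 < K + 1 by rewrite ltr_wpDl.
  exists (e / (K + 1)); first by rewrite divr_gt0.
  move=> s s0; rewrite ltr_pdivlMr // => st.
  apply: le_lt_trans st; rewrite mulrDr mulr1.
  have [ts|st|->] := ltrgtP t s; last by rewrite !subrr normr0 mul0r addr0.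
    by rewrite (le_trans (KP _ _ t0 ts)) // mulrC lerDl subr_ge0 ltW.
  by rewrite distrC (le_trans (KP _ _ s0 st)) // mulrC lerDl subr_ge0 ltW.
Qed.

Lemma redistributed_serviceE t i : 0 <= t ->
  redistributed_service t i = U t i - U0 i - H t i + alpha i * t.
Proof.
move=> /wU[_ /(_ i) UE].
by rewrite /redistributed_service [in RHS]UE; ring.
Qed.

End prelimit.

(** * The path in the invariant manifold *)

Section lipschitz_approximation.
Context {R : realType}.

(** Take the supremum of the [t] for which the given [e] admits a modulus on [[0, t]]. Continuity at
    the supremum extends the modulus beyond it unless it is already [T]. *)
Lemma uniform_continuity_segment (f : R -> R) (T e : R) :
  {within `[0, +oo[, continuous f} -> 0 <= T -> 0 < e ->
  exists2 d, 0 < d & forall u v, 0 <= u <= T -> 0 <= v <= T ->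
    `|u - v| < d -> `|f u - f v| < e.
Proof.
move=> /within_half_lineP cf T0 e0.
pose P t d := forall u v, 0 <= u <= t -> 0 <= v <= t -> `|u - v| < d -> `|f u - f v| < e.
pose E := [set t | 0 <= t <= T /\ exists2 d, 0 < d & P t d].
have E0 : E 0.
  split; first by rewrite lexx.
  exists 1 => // u v; rewrite -!eq_le => /eqP <- /eqP <- _.
  by rewrite subrr normr0.
have hE : has_sup E by split; [exists 0|exists T => t [/andP[]]].
have s0 : 0 <= sup E by apply: sup_upper_bound.
have sT : sup E <= T by apply: sup_le_ub; [exists 0|move=> t [/andP[]]].
have e2 : 0 < e / 2 by rewrite divr_gt0.
have [d1 d10 d1P] := cf _ s0 _ e2.
have d12 : 0 < d1 / 2 by rewrite divr_gt0.
have [t [/andP[t0 tT] [d2 d20 d2P]] st] := sup_adherent d12 hE.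
have ts : t <= sup E by apply: sup_upper_bound => //; split; [rewrite t0|exists d2].
pose v := Num.min T (sup E + d1 / 2).
(* Two points of [[0, v]] closer than [d1 / 2] either both lie in [[0, t]] or both lie within [d1]
   of the supremum. *)
have vP : P v (Num.min d2 (d1 / 2)).
  move=> a c; rewrite /v !le_min lt_min.
  move=> /and3P[a0 aT ad] /and3P[c0 cT cd] /andP[acd2 acd1].
  have [/andP[at_ ct]|] := boolP ((a <= t) && (c <= t)).
    by apply: d2P => //; rewrite ?a0 ?c0.
  rewrite negb_and -!ltNge => act.
  have an : `|f a - f (sup E)| < e / 2.
    apply: d1P => //; move: acd1; rewrite !ltr_norml => /andP[? ?].
    by apply/andP; split; case/orP: act => ?; lra.
  have cn : `|f c - f (sup E)| < e / 2.
    apply: d1P => //; move: acd1; rewrite !ltr_norml => /andP[? ?].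
    by apply/andP; split; case/orP: act => ?; lra.
  by move: an cn; rewrite !ltr_norml => /andP[? ?] /andP[? ?]; apply/andP; split; lra.
have d0 : 0 < Num.min d2 (d1 / 2) by rewrite lt_min d20.
have vs : v <= sup E.
  apply: sup_upper_bound => //; split; last by exists (Num.min d2 (d1 / 2)).
  by rewrite /v ge_min lexx /= le_min T0 addr_ge0 // ltW.
have vT : v = T.
  apply/min_idPl; rewrite leNgt; apply/negP => h; move: vs.
  by rewrite /v (min_idPr (ltW h)) gerDl leNgt d12.
by exists (Num.min d2 (d1 / 2)) => //; rewrite -vT.
Qed.

(* The approximation is the inf-convolution of [f] with a steep cone. *)
Lemma lipschitz_approximation (f : R -> R) (T w : R) :
  {within `[0, +oo[, continuous f} -> 0 <= T -> 0 < w ->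
  exists g : R -> R, (exists2 L, 0 <= L & forall s t, `|g t - g s| <= L * `|t - s|) /\
    forall t, 0 <= t <= T -> `|f t - g t| <= w.
Proof.
move=> cf T0 w0; have [d d0 dP] := uniform_continuity_segment cf T0 w0.
have [M M0 fM] : exists2 M : R, 0 <= M & forall t : R, 0 <= t <= T -> `|f t| <= M.
  have cnf : {within `[0, T], continuous (fun t => `|f t|)}.
    have cf' : {within `[0, T], continuous f}.
      by apply: continuous_subspaceW cf => x /=; rewrite !in_itv/= andbT => /andP[].
    by move=> t; apply: cvg_norm; exact: cf'.
  have [c _ cmax] := EVT_max T0 cnf.
  by exists `|f c| => // t tT; apply: cmax; rewrite in_itv.
(* With this slope a point [s] at distance at least [d] from [t] contributes at least
   [- M + 2 * M >= f t], and closer points lose less than [w] by uniform continuity. *)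
pose L := 2 * M / d.
have L0 : 0 <= L by rewrite divr_ge0 ?(ltW d0) // mulr_ge0.
pose V t := [set f s + L * `|t - s| | s in `[0, T]%classic].
have V0 t : V t !=set0 by exists (f 0 + L * `|t - 0|), 0; rewrite //= in_itv/= lexx.
have Vlb t : has_lbound (V t).
  exists (- M) => y [s /=]; rewrite in_itv/= => /fM; rewrite ler_norml => /andP[fs _] <-.
  by rewrite (le_trans fs) // lerDl mulr_ge0.
exists (fun t => inf (V t)); split.
  exists L => // s t.
  have one u v : inf (V u) - L * `|u - v| <= inf (V v).
    apply: lb_le_inf => // _ [x xT <-].
    rewrite lerBlDr (@le_trans _ _ (f x + L * `|u - x|)) //.
      by apply: ge_inf => //; exists x.
    rewrite -addrA lerD2l -mulrDr ler_wpM2l // [leRHS]addrC.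
    exact: ler_distD.
  rewrite ler_norml; have := one t s; have := one s t.
  by rewrite [ `|s - t|]distrC => ? ?; apply/andP; split; lra.
move=> t tT.
have h1 : inf (V t) <= f t.
  by apply: ge_inf => //; exists t; rewrite ?subrr ?normr0 ?mulr0 ?addr0 //= in_itv.
have h2 : f t - w <= inf (V t).
  apply: lb_le_inf => // y [s /=]; rewrite in_itv/= => sT <-.
  have [ts|ts] := ltP `|t - s| d.
    have := dP _ _ tT sT ts; rewrite ltr_norml => /andP[_ ?].
    have : 0 <= L * `|t - s| by rewrite mulr_ge0.
    lra.
  have : 2 * M <= L * `|t - s|.
    by rewrite -[2 * M](divfK (lt0r_neq0 d0)) ler_wpM2l.
  have := fM _ tT; have := fM _ sT; rewrite !ler_norml => /andP[? ?] /andP[? ?]; lra.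
by rewrite ger0_norm ?subr_ge0 //; lra.
Qed.

End lipschitz_approximation.

Section critical_classes.
Context {R : realType} {J : nat}.
Variables (S : {set 'I_J}) (beta : 'I_J -> R).
Hypotheses (beta_gt0 : forall i, 0 < beta i) (beta_sum : \sum_i beta i = 1)
  (S_proper : S != [set: 'I_J]%SET).

Let K := critical S.
Let bK : K -> R := critical_weight (S := S) beta.
Let betaK := \sum_(k | k \notin S) beta k.

Lemma sum_critical (F : 'I_J -> R) : \sum_(k : K) F (val k) = \sum_(i | i \notin S) F i.
Proof. by rewrite (big_sub [pred i | i \notin S]). Qed.

Lemma sum_split (F : 'I_J -> R) :
  \sum_i F i = \sum_(k : K) F (val k) + \sum_(i in S) F i.
Proof. by rewrite sum_critical (bigID (mem S)) /= addrC. Qed.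

Lemma extend0_critical (x : R -> K -> R) t (k : K) : extend0 x t (val k) = x t k.
Proof. by rewrite /extend0 valK. Qed.

Lemma extend0_subcritical (x : R -> K -> R) t i : i \in S -> extend0 x t i = 0.
Proof. by move=> iS; rewrite /extend0 insubN // negbK. Qed.

Lemma critical_weight_total_gt0 : 0 < betaK.
Proof.
have [i iS] : exists i, i \notin S.
  apply/existsP; rewrite -negb_forall; apply: contra S_proper => /forallP h.
  by apply/eqP/setP => i; rewrite inE h.
by rewrite /betaK (bigD1 i) //= ltr_pwDl // sumr_ge0 // => j _; exact: ltW.
Qed.
Let betaK_gt0 := critical_weight_total_gt0.

Lemma critical_weight_gt0 k : 0 < bK k.
Proof. by rewrite divr_gt0. Qed.

Lemma critical_weight_sum : \sum_k bK k = 1.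
Proof. by rewrite -mulr_suml sum_critical divff // gt_eqF. Qed.

Lemma critical_weight_le1 k : bK k <= 1.
Proof. exact: (weight_le1 critical_weight_gt0 critical_weight_sum). Qed.

Section reference.
Variables (C q L : R) (nu kappa : 'I_J -> R) (g : 'I_J -> R -> R).
Hypotheses (kappa_ge0 : forall j, 0 <= kappa j)
  (kappaS : forall j, (0 < kappa j) = (j \in S))
  (nuE : forall j, nu j = beta j * (C - kappa j)) (nu_sum : \sum_j nu j = 0)
  (g_lip : forall j s t, `|g j t - g j s| <= L * `|t - s|)
  (q_large : forall j, j \in S -> J%:R * L / betaK + L / beta j <= q * kappa j).
Variables (phi eta : R -> K -> R).
Hypothesis reg : regulated bK phi eta.

(** Chosen so that the path [phi] extended by zero has input [g i t + q * nu i * t] on the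
    subcritical classes. On the critical ones the share of [\sum_(j in S) g j] is taken back from
    [phi - eta], which leaves the critical part of the input plus the drift [q * nu i * t]. *)
Definition reference_regulator (t : R) (i : 'I_J) : R :=
  (if insub i : option K is Some k then eta t k + bK k * \sum_(j in S) g j t
   else - g i t) - q * nu i * t.

Lemma reference_critical t (k : K) : reference_regulator t (val k) =
  eta t k + bK k * \sum_(j in S) g j t - q * nu (val k) * t.
Proof. by rewrite /reference_regulator valK. Qed.

Lemma reference_subcritical t i : i \in S ->
  reference_regulator t i = - g i t - q * nu i * t.
Proof. by move=> iS; rewrite /reference_regulator insubN // negbK. Qed.

Lemma reference_sum t : \sum_i reference_regulator t i = \sum_k eta t k.
Proof.
rewrite sum_split; under eq_bigr do rewrite reference_critical.
under [X in _ + X]eq_bigr => i iS do rewrite reference_subcritical //.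
rewrite !big_split /= -mulr_suml critical_weight_sum mul1r !sumrN.
rewrite (sum_critical (fun i => q * nu i * t)).
have : \sum_i q * nu i * t = 0 by rewrite -mulr_suml -mulr_sumr nu_sum mulr0 mul0r.
rewrite (bigID (mem S)) /=; lra.
Qed.

(** The totals are those of [eta], and the extended path vanishes exactly when [phi] does. A class
    busy all along is critical. Against another critical class the order is inherited from [eta];
    against a subcritical class [j] the drift [q * kappa j] outweighs all variations of [g]. *)
Lemma reference_regulated : regulated beta (extend0 phi) reference_regulator.
Proof.
have [phi0 regK ceta] := reg.
have L0 (j : 'I_J) : 0 <= L.
  by have := g_lip j 0 1; rewrite subr0 normr1 mulr1; apply: le_trans.
have gB s t j : s < t -> `|g j t - g j s| <= L * (t - s).
  by move=> st; have := g_lip j s t; rewrite [ `|t - s|]gtr0_norm ?subr_gt0.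
split.
- move=> t t0 i; rewrite /extend0; case: insubP => //= k _ _; exact: phi0.
- move=> s t s0 st.
  have [sumK0 sumK1 ordK] := regK _ _ s0 st.
  split.
  + by rewrite sumrB !reference_sum -sumrB.
  + move=> h; rewrite sumrB !reference_sum -sumrB; apply: sumK1 => x [u ust <-].
    have [|i] := h (extend0 phi u); first by exists u.
    have [iS|iS] := boolP (i \in S); first by rewrite extend0_subcritical // eqxx.
    by rewrite -[i]/(val (Sub i iS : K)) extend0_critical; exists (Sub i iS).
  + move=> i h j.
    have win u : s < u <= t -> 0 < extend0 phi u i.
      by move=> sut; apply: (h (extend0 phi u)); exists u; rewrite //= in_itv.
    have iS : i \notin S.
      apply/negP => iS; have := win t; rewrite st lexx => /(_ isT).
      by rewrite extend0_subcritical // ltxx.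
    pose k : K := Sub i iS; have ik : i = val k by [].
    have ordk l : (eta t k - eta s k) / bK k <= (eta t l - eta s l) / bK l.
      apply: ordK => x [u /=]; rewrite in_itv/= => /win.
      by rewrite ik extend0_critical => + <-.
    (* The ratio of the busy class is the smallest, hence at most the weighted mean, which is the
       nonpositive total. *)
    have etak0 : (eta t k - eta s k) / bK k <= 0.
      have sum0 : \sum_l (eta t l - eta s l) <= 0.
        apply: sumK1 => x [u /=]; rewrite in_itv/= => /win.
        by rewrite ik extend0_critical => + <-; exists k; rewrite gt_eqF.
      apply: le_trans sum0; rewrite -[X in X <= _]mul1r -critical_weight_sum mulr_suml.
      apply: ler_sum => l _; have := ordk l; rewrite ler_pdivlMr ?critical_weight_gt0 //.
      by rewrite mulrC.
    set dG := \sum_(j in S) g j t - \sum_(j in S) g j s.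
    have kap0 (l : K) : kappa (val l) = 0.
      apply/eqP; rewrite eq_le kappa_ge0 andbT leNgt kappaS; exact: (valP l).
    (* [kappa] vanishes on critical classes, so the drift contributes the same [- q * C * (t - s)]
       to the ratio of every class, up to the extra [q * kappa j * (t - s)] on subcritical ones. *)
    have critE (l : K) : (reference_regulator t (val l) - reference_regulator s (val l)) / beta (val l)
        = ((eta t l - eta s l) / bK l + dG) / betaK - q * C * (t - s).
      have b0 : beta (val l) != 0 by rewrite gt_eqF.
      have B0 : betaK != 0 by rewrite gt_eqF.
      rewrite !reference_critical nuE kap0 /dG /bK /critical_weight -/betaK.
      by field; rewrite ?B0 ?b0.
    rewrite ik critE; have [jS|jS] := boolP (j \in S); last first.
      rewrite -[j]/(val (Sub j jS : K)) critE lerD2r ler_pM2r ?invr_gt0 //.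
      by rewrite lerD2r.
    rewrite !reference_subcritical // nuE.
    have b0 : beta j != 0 by rewrite gt_eqF.
    have -> : (- g j t - q * (beta j * (C - kappa j)) * t -
        (- g j s - q * (beta j * (C - kappa j)) * s)) / beta j =
        - ((g j t - g j s) / beta j) + q * kappa j * (t - s) - q * C * (t - s).
      by field.
    rewrite lerD2r.
    have ts0 : 0 < t - s by rewrite subr_gt0.
    have h1 : dG / betaK <= J%:R * L / betaK * (t - s).
      rewrite [leRHS]mulrAC ler_pM2r ?invr_gt0 // /dG -sumrB.
      apply: (@le_trans _ _ (\sum_(j in S) L * (t - s))).
        by apply: ler_sum => l _; apply: le_trans (gB _ _ l st); exact: ler_norm.
      rewrite sumr_const -[X in X <= _]mulr_natl -mulrA ler_wpM2r //.
        by rewrite mulr_ge0 ?(ltW ts0) ?(L0 j).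
      by rewrite ler_nat -[X in (_ <= X)%N]card_ord max_card.
    have h2 : (g j t - g j s) / beta j <= L / beta j * (t - s).
      rewrite [leRHS]mulrAC ler_pM2r ?invr_gt0 //.
      by apply: le_trans (gB _ _ j st); exact: ler_norm.
    have h3 : (eta t k - eta s k) / bK k / betaK <= 0.
      by rewrite pmulr_lle0 ?invr_gt0.
    have : (J%:R * L / betaK + L / beta j) * (t - s) <= q * kappa j * (t - s).
      by rewrite ler_wpM2r ?(ltW ts0) // q_large.
    rewrite mulrDl => h4; rewrite mulrDl (le_trans (lerD h3 h1)) // add0r.
    by rewrite [leRHS]addrC lerBrDr (le_trans _ h4) // lerD2l.
- have cg j : {within `[0, +oo[, continuous (g j)}.
    apply/within_half_lineP => t t0 e e0.
    have L1 : 0 < L + 1 by rewrite ltr_wpDl // (L0 j).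
    exists (e / (L + 1)); first by rewrite divr_gt0.
    move=> s s0; rewrite ltr_pdivlMr // => st; apply: le_lt_trans (g_lip j t s) _.
    apply: le_lt_trans st; rewrite mulrDr mulr1 mulrC lerDl //.
  have clin (a : R) : {within `[0, +oo[, continuous (fun t : R => a * t)}.
    by apply: continuous_subspaceT => t; apply: cvgM; [exact: cvg_cst|exact: cvg_id].
  have cG : {within `[0, +oo[, continuous (fun t => \sum_(j in S) g j t)}.
    by move=> t; apply: cvg_big => [|j _]; [exact: add_continuous|exact: cg].
  move=> i; rewrite /reference_regulator; case: insubP => [k _ _|_] t.
    apply: cvgB; last exact: clin.
    by apply: cvgD; [exact: ceta|apply: cvgM; [exact: cvg_cst|exact: cG]].
  by apply: cvgB; [apply: cvgN; exact: cg|exact: clin].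
Qed.

End reference.

End critical_classes.

(** * State space collapse onto the invariant manifold *)

Section collapse.
Context {R : realType} {J : nat}.
Variables (S : {set 'I_J}) (beta : 'I_J -> R).
Hypotheses (beta_gt0 : forall i, 0 < beta i) (beta_sum : \sum_i beta i = 1)
  (S_proper : S != [set: 'I_J]%SET).
Variables (C : R) (nu kappa : 'I_J -> R).
Hypotheses (kappa_ge0 : forall j, 0 <= kappa j)
  (kappaS : forall j, (0 < kappa j) = (j \in S))
  (nuE : forall j, nu j = beta j * (C - kappa j)) (nu_sum : \sum_j nu j = 0).

Let bK := critical_weight (S := S) beta.

(** The Lipschitz approximations of [D] are fixed first, at an accuracy dictated by the stability
    constant; their Lipschitz constant is then dominated once [q n] is large. The reference path and
    [phi n] have inputs within [delta] of each other, so stability compares the paths themselves. *)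
Lemma workload_collapse (psi UK : R -> critical S -> R) (D : R -> 'I_J -> R)
    (phi eta : nat -> R -> 'I_J -> R) (q : nat -> R) :
  path_continuous D -> path_continuous psi ->
  (forall t k, psi t k = D t (val k) + bK k * \sum_(j in S) D t j) ->
  (forall j, j \in S -> D 0 j = 0) ->
  gps_ESM bK psi UK ->
  (\forall n \near \oo, regulated beta (phi n) (eta n) /\
     forall i, eta n 0 i = 0) ->
  q n @[n --> \oo] --> +oo ->
  (forall T e : R, 0 <= T -> 0 < e -> \forall n \near \oo, forall t i, 0 <= t <= T ->
     `|phi n t i - eta n t i - q n * nu i * t - D t i| <= e) ->
  forall T e : R, 0 <= T -> 0 < e -> \forall n \near \oo, forall t i, 0 <= t <= T ->
     `|phi n t i - extend0 UK t i| <= e.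
Proof.
move=> cD cpsi psiE D0 [etaK esp] reg qoo Dlim T e T0 e0.
have bK_gt0 := critical_weight_gt0 beta_gt0 S_proper.
have bK_sum := critical_weight_sum beta_gt0 S_proper.
have bK_le1 := critical_weight_le1 beta_gt0 S_proper.
have regK := ESP_regulated bK_gt0 bK_sum cpsi esp.
have [etaKE etaK0] := ESP_input esp.
have [Cst Cst0 stab] := regulated_stability beta_gt0 beta_sum.
pose delta := e / Cst.
have delta0 : 0 < delta by rewrite divr_gt0.
(* Replacing [D] by its approximations costs at most [w] on a subcritical class and [J * w] on a
   critical one; the other half of [delta] pays for the convergence of the inputs. *)
pose w := delta / 2 / (J%:R + 1).
have J1 : 0 < J%:R + 1 :> R by rewrite ltr_wpDl.
have w0 : 0 < w by rewrite !divr_gt0.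
have Jw : (J%:R + 1) * w = delta / 2 by rewrite mulrC divfK // gt_eqF.
have Jw0 : 0 <= J%:R * w by rewrite mulr_ge0 ?(ltW w0).
have /choice[g gP] := fun j => lipschitz_approximation (cD j) T0 w0.
have /choice[l lP] : forall j, exists l, 0 <= l /\
    forall s t, `|g j t - g j s| <= l * `|t - s|.
  by move=> j; have [[l l0 lP] _] := gP j; exists l.
pose L := \sum_j l j.
have g_lip j s t : `|g j t - g j s| <= L * `|t - s|.
  have [_ /(_ s t) h] := lP j; apply: (le_trans h); rewrite ler_wpM2r //.
  by rewrite /L (bigD1 j) //= lerDl sumr_ge0 // => i _; have [] := lP i.
have gD t j : 0 <= t <= T -> `|D t j - g j t| <= w by have [_ h] := gP j; exact: h.
have sumg t : 0 <= t <= T -> `|\sum_(j in S) D t j - \sum_(j in S) g j t| <= J%:R * w.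
  move=> tT; rewrite -sumrB (le_trans (ler_norm_sum _ _ _)) //.
  apply: (@le_trans _ _ (\sum_(j in S) w)); first by apply: ler_sum => j _; exact: gD.
  rewrite sumr_const -[leLHS]mulr_natl ler_wpM2r ?(ltW w0) //.
  by rewrite ler_nat -[leqRHS]card_ord max_card.
have bKsum t k : 0 <= t <= T ->
    `|bK k * (\sum_(j in S) D t j - \sum_(j in S) g j t)| <= J%:R * w.
  move=> /sumg h; rewrite normrM (gtr0_norm (bK_gt0 k)) -[leRHS]mul1r.
  by apply: ler_pM => //; exact: ltW.
have qbig : \forall n \near \oo, forall j, j \in S ->
    J%:R * L / (\sum_(k | k \notin S) beta k) + L / beta j <= q n * kappa j.
  apply: filter_forall => j; have [jS|jS] := boolP (j \in S); last first.
    by apply: nearW => n.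
  have kj : 0 < kappa j by rewrite kappaS.
  near=> n => _; rewrite -ler_pdivrMr //.
  by near: n; move/cvgryPge: qoo; apply.
have delta2 : 0 < delta / 2 by rewrite divr_gt0.
have Dn := Dlim T _ T0 delta2.
near=> n; move=> t i tT.
have [regn etan0] : regulated beta (phi n) (eta n) /\ forall i, eta n 0 i = 0.
  by near: n; exact: reg.
have qn : forall j, j \in S ->
    J%:R * L / (\sum_(k | k \notin S) beta k) + L / beta j <= q n * kappa j.
  by near: n; exact: qbig.
have regref := reference_regulated beta_gt0 S_proper kappa_ge0 kappaS nuE nu_sum
  g_lip qn regK.
have Dnn : forall t i, 0 <= t <= T ->
    `|phi n t i - eta n t i - q n * nu i * t - D t i| <= delta / 2.
  by near: n; exact: Dn.
have eE : e = Cst * delta by rewrite mulrC divfK // gt_eqF.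
rewrite eE; apply: (stab T _ _ _ _ _ delta0 regn regref) tT.
have T00 : (0 : R) <= 0 <= T by apply/andP.
split.
  (* The reference regulator need not start at zero, but [D] vanishes at time 0 on the subcritical
     classes, so [g] is within [w] of zero there. *)
  move=> j; rewrite etan0 sub0r normrN; have [jS|jS] := boolP (j \in S).
    rewrite reference_subcritical // mulr0 subr0 normrN.
    have := gD 0 j T00; rewrite D0 // sub0r normrN => h; apply: (le_trans h).
    by move: Jw Jw0; rewrite mulrDl mul1r; lra.
  rewrite -[j]/(val (Sub j jS : critical S)) reference_critical mulr0 subr0 etaK0 add0r.
  have := bKsum 0 (Sub j jS) T00; rewrite (eq_bigr (fun=> 0)) => [|k]; last exact: D0.
  rewrite big1 // sub0r mulrN normrN => h; apply: (le_trans h).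
  by move: Jw w0; rewrite mulrDl mul1r; lra.
move=> u j uT; have := Dnn u j uT; have [jS|jS] := boolP (j \in S).
  rewrite reference_subcritical // extend0_subcritical //.
  have := gD u j uT; rewrite !ler_norml => /andP[? ?] /andP[? ?].
  by move: Jw Jw0; rewrite mulrDl mul1r => ? ?; apply/andP; split; lra.
rewrite -[j]/(val (Sub j jS : critical S)) reference_critical extend0_critical.
set k : critical S := Sub j jS.
have := bKsum u k uT; have u0 : 0 <= u by case/andP: uT.
have := etaKE u k u0; rewrite psiE mulrBr -/bK.
rewrite !ler_norml => ? /andP[? ?] /andP[? ?].
by move: Jw w0; rewrite mulrDl mul1r => ? ?; apply/andP; split; lra.
Unshelve. all: by end_near. Qed.

End collapse.

(** * Convergence *)

Section weak_convergence.
Context {R : realType} {A : finType}.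
Context {d : measure_display} {T : measurableType d} (P : probability T R).
Implicit Types (X : T -> R -> A -> R).

Lemma path_measurable_preimage X (C : set (R -> A -> R)) :
  cadlag_process X -> path_measurable C -> measurable (X @^-1` C).
Proof.
move=> [cX mX]; apply: (@smallest_sub _ _ _ [set C | measurable (X @^-1` C)]).
  split => /=.
  - by rewrite preimage_set0.
  - move=> B mB; have -> : X @^-1` ([set x | cadlag x] `\` B) = ~` (X @^-1` B).
      by apply/seteqP; split => w /= => [[]|].
    exact: measurableC.
  - by move=> F mF; rewrite preimage_bigcup; exact: bigcup_measurable.
move=> _ [t [i [Y [t0 mY ->]]]] /=.
have -> : X @^-1` [set x | cadlag x /\ Y (x t i)] = (fun w => X w t i) @^-1` Y.
  by apply/seteqP; split => w /= => [[]|].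
by rewrite -[X in measurable X]setTI; exact: mX.
Qed.

Lemma path_test_measurable X f : cadlag_process X -> path_test_function f ->
  measurable_fun setT (fun w => f (X w)).
Proof.
move=> pX [_ _ mf] _ Y mY; rewrite setTI.
have -> : (fun w => f (X w)) @^-1` Y = X @^-1` [set x | cadlag x /\ Y (f x)].
  by apply/seteqP; split => w /= => [|[]] //; split => //; have [] := pX.
by apply: path_measurable_preimage => //; exact: mf.
Qed.

(** Test functions are continuous relative to the cadlag paths, to which all paths involved belong,
    and are bounded there; dominated convergence with a constant bound applies. *)
Lemma ae_uoc_weak_cvg (X_ : nat -> T -> R -> A -> R) X :
  (forall n, cadlag_process (X_ n)) -> cadlag_process X ->
  {ae P, forall w, uoc_cvg (fun n => X_ n w) (X w)} -> weak_cvg P X_ X.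
Proof.
move=> pX_ pX cvX; split => // f tf; rewrite !unlock.
have [[M fM] cf mf] := tf.
have fcv : {ae P, forall w, setT w -> (f (X_ n w))%:E @[n --> \oo] --> (f (X w))%:E}.
  apply: ae_impl cvX => w Xw _; apply: cvg_EFin; first exact: nearW.
  have /subspace_continuousP/(_ (X w)) cfX := cf.
  have cXw : cadlag (X w) by have [] := pX.
  apply: cvg_comp (cfX cXw) => B; rewrite /within/= => nB.
  have := Xw _ nB; rewrite /= /nbhs/=; apply: filterS => n; apply.
  by have [] := pX_ n.
have mfX n : measurable_fun setT (fun w => (f (X_ n w))%:E).
  by apply/measurable_EFinP; exact: path_test_measurable.
have mfX' : measurable_fun setT (fun w => (f (X w))%:E).
  by apply/measurable_EFinP; exact: path_test_measurable.
have iM : P.-integrable setT (EFin \o cst M) by exact: finite_measure_integrable_cst.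
have fM' : {ae P, forall w n, setT w -> (`|(f (X_ n w))%:E| <= (EFin \o cst M) w)%E}.
  by apply: aeW => w n _; rewrite lee_fin fM //; have [] := pX_ n.
by have [_ _] := dominated_convergence measurableT mfX mfX' fcv iM fM'.
Qed.

End weak_convergence.

(** * Uniform convergence on compact sets in epsilon form *)

Section uniform_on_compacts.
Context {R : realType} {A : finType}.

Lemma ptws_entourage_ball (i : A) (e : R) : 0 < e ->
  entourage [set p : {ptws A -> R} * {ptws A -> R} | `|p.1 i - p.2 i| < e].
Proof.
move=> e0.
pose V := [set p : R * R | `|p.1 - p.2| < e].
have entV : entourage V by rewrite -entourage_ballE; exists e.
pose W := [set p : {ptws A -> R} * {ptws A -> R} | `|p.1 i - p.2 i| < e].
have entW : @entourage (initial_topology (@proj A (fun=> R) i)) W by exists V.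
have iW : `[< @entourage (initial_topology (@proj A (fun=> R) i)) ((i : {classic A}), W).2 >].
  exact/asboolP.
exists W => //.
unshelve eexists; first exact: [fset (exist _ ((i : {classic A}), W) iW)]%fset.
  by move=> p _; exact/mem_set.
by rewrite bigcap_fset big_seq_fset1.
Qed.

Lemma ptws_entourage_le (E : set ({ptws A -> R} * {ptws A -> R})) :
  entourage E -> exists2 e, 0 < e &
    forall x y : A -> R, (forall i, `|x i - y i| < e) -> E (x, y).
Proof.
move=> [B [D sD DB] BE].
have [e e0 eP] : exists2 e, 0 < e & forall p, p \in D ->
    forall x y : A -> R, (forall i, `|x i - y i| < e) -> (projT1 p).2 (x, y).
  apply: near_right0_ex.
  apply: (@filterS _ (0 : R)^'+ _ (\bigcap_(p in [set` D]) [set e : R |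
    forall x y : A -> R, (forall i, `|x i - y i| < e) -> (projT1 p).2 (x, y)])).
    by move=> e he p pD; exact: he.
  apply: filter_bigI.
  move=> [[i W] iW] _ /=; have /asboolP[V entV VW] := iW.
  have [e /= e0 eV] : entourage_ (@ball R R) V by rewrite entourage_ballE.
  near=> e' => x y xy; apply: VW; apply: eV; apply: lt_le_trans (xy i) _.
  by near: e'; exact: nbhs_right_le.
exists e => // x y xy; apply: BE; rewrite -DB => p pD; exact: eP.
Unshelve. all: by end_near. Qed.

Lemma uoc_cvgP (x_ : nat -> R -> A -> R) (x : R -> A -> R) :
  uoc_cvg x_ x <-> forall T e : R, 0 <= T -> 0 < e ->
    \forall n \near \oo, forall t i, 0 <= t <= T -> `|x_ n t i - x t i| <= e.
Proof.
split=> [/fam_cvgP xcv T e T0 e0|xcv].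
  have /xcv : @time_windows R `[0, T]%classic by exists T.
  have ent : entourage
      [set p : {ptws A -> R} * {ptws A -> R} | forall i, `|p.1 i - p.2 i| < e].
    apply: (@filter_forall _ A (fun i => [set p : {ptws A -> R} * {ptws A -> R} |
      `|p.1 i - p.2 i| < e]) entourage _) => i; exact: ptws_entourage_ball.
  have nb : nbhs (x : {uniform` `[0, T]%classic -> {ptws A -> R}})
      [set h : R -> A -> R | forall t, `[0, T]%classic t -> forall i, `|x t i - h t i| < e].
    apply/uniform_nbhs.
    by exists [set p : {ptws A -> R} * {ptws A -> R} | forall i, `|p.1 i - p.2 i| < e]; split.
  move=> /(_ _ nb) near_x; have : \forall n \near \oo,
    forall t, `[0, T]%classic t -> forall i, `|x t i - x_ n t i| < e by exact: near_x.
  apply: filterS => n h t i tT.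
  by rewrite distrC ltW // h //= in_itv.
apply/fam_cvgP => _ [T _ <-] B /uniform_nbhs[E [entE EB]].
suff : \forall n \near \oo, B (x_ n) by [].
have [e e0 eE] := ptws_entourage_le entE.
have e2 : 0 < e / 2 by rewrite divr_gt0.
(* A window with negative endpoint is empty. *)
have [T0|T0] := leP 0 T; last first.
  apply: nearW => n; apply: EB => t /=; rewrite in_itv/= => /andP[t0 tT].
  by move: T0; rewrite ltNge (le_trans t0).
apply: filterS (xcv T _ T0 e2) => n h; apply: EB => t /=; rewrite in_itv/= => tT.
apply: eE => i; rewrite distrC (le_lt_trans (h t i tT)) //.
by rewrite gtr_pMr // invf_lt1 ?ltr1n.
Unshelve. all: by end_near. Qed.

End uniform_on_compacts.

(** * Measurability of the extended Skorokhod map *)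

Section rational_times.
Context {R : realType}.

(** By density of the rationals, the bound involves countably many times only. Rational fractions of
    [t] are used so that the end [t] is reached whatever its value. *)
Lemma le_on_rational_times (g : R -> R) (t c : R) :
  {within `[0, +oo[, continuous g} -> 0 <= t ->
  (forall r : rat, 0 <= r <= 1 -> `|g (ratr r * t)| <= c) ->
  forall u, 0 <= u <= t -> `|g u| <= c.
Proof.
move=> /within_half_lineP cg t0 gr u /andP[u0 ut]; rewrite leNgt; apply/negP => gu.
have gu0 : 0 < `|g u| - c by rewrite subr_gt0.
have [d d0 dP] := cg u u0 _ gu0.
have [r r01 ru] : exists2 r : rat, 0 <= r <= 1 & `|ratr r * t - u| < d.
  move: t0; rewrite le_eqVlt => /predU1P[t0|t0].
    exists 0; rewrite ?lexx ?ler01 // raddf0 mul0r sub0r normrN.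
    by have -> : u = 0 by [apply/le_anti; rewrite u0 t0 ut]; rewrite normr0.
  have [r] : exists r : rat, ratr r \in
      `]Num.max 0 ((u - d) / t), Num.min 1 ((u + d) / t)[.
    apply/rat_in_itvoo; rewrite gt_max !lt_min ltr01 /= divr_gt0 ?ltr_wpDl //=.
    by rewrite ltr_pdivrMr // mul1r ltr_pM2r ?invr_gt0 //; lra.
  rewrite in_itv/= gt_max lt_min => /andP[/andP[r0 rl] /andP[r1 ru]].
  exists r; first by rewrite -(ler0q R) -(ler_rat R) rmorph1 !ltW.
  move: rl ru; rewrite ltr_pdivrMr // ltr_pdivlMr // => rl ru.
  by rewrite ltr_norml; apply/andP; split; lra.
have rt0 : 0 <= ratr r * t by case/andP: r01 => r0 _; rewrite mulr_ge0 // ler0q.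
have := dP _ rt0 ru; have := gr r r01.
have := lerB_dist (g u) (g (ratr r * t)); rewrite [ `|g u - _|]distrC; lra.
Qed.

End rational_times.

Section measurable_regulation.
Context {R : realType} {A : finType}.
Context {d : measure_display} {T : measurableType d}.
Variable b : A -> R.
Hypotheses (b_gt0 : forall i, 0 < b i) (b_sum : \sum_i b i = 1).
Variables (X phi : T -> R -> A -> R).
Hypotheses (cX : forall w, path_continuous (X w))
  (mX : forall t i, 0 <= t -> measurable_fun setT (fun w => X w t i))
  (ESM : forall w, gps_ESM b (X w) (phi w)).

(** A code describes a step function on [[0, 1]], time being rescaled by [t]: the number of cells
    per unit and the list of rational values. There are countably many codes. *)
Let code := (nat * seq {ffun A -> rat})%type.
Let step (q : code) (r : R) (i : A) : R :=
  ratr (nth [ffun=> 0] q.2 (Num.truncn (r * q.1%:R)) i).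

Let tube (t : R) (N : nat) (q : code) : set T := [set w |
  forall ri : rat * A, 0 <= ri.1 <= 1 ->
    `|X w (ratr ri.1 * t) ri.2 - step q (ratr ri.1) ri.2| <= N.+1%:R^-1].

Let measurable_tube t N q : 0 <= t -> measurable (tube t N q).
Proof.
move=> t0.
pose F (ri : rat * A) := if 0 <= ri.1 <= 1 then (fun w => X w (ratr ri.1 * t) ri.2) @^-1`
  [set x | N.+1%:R^-1 < `|x - step q (ratr ri.1) ri.2|] else set0.
have -> : tube t N q = ~` \bigcup_ri F ri.
  apply/seteqP; split => w /=.
    by move=> tw [ri _]; rewrite /F; case: ifPn => // /tw /=; rewrite leNgt => /negP.
  move=> h ri r01; rewrite leNgt; apply/negP => hr; apply: h; exists ri => //.
  by rewrite /F r01.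
apply: measurableC; apply: countable_bigcupT_measurable => [|ri]; first exact: countableP.
rewrite /F; case: ifPn => // /andP[r0 _].
rewrite -[X in measurable X]setTI; apply: mX => //; first by rewrite mulr_ge0 // ler0q.
suff -> : [set x | N.+1%:R^-1 < `|x - step q (ratr ri.1) ri.2|] =
    (fun x => `|x - step q (ratr ri.1) ri.2|) @^-1` `]N.+1%:R^-1, +oo[%classic.
  have mabs : measurable_fun setT (fun x : R => `|x - step q (ratr ri.1) ri.2|).
    by apply: measurableT_comp => //; exact: measurable_funB.
  by rewrite -[X in measurable X]setTI; exact: mabs.
by apply/seteqP; split => x /=; rewrite in_itv/= andbT.
Qed.

Let tube_cover t N w : 0 <= t -> exists q, tube t N q w.
Proof.
(* One half of the radius is for the oscillation of the path over a grid cell, the other for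
   rounding its values to rationals. *)
move=> t0; pose e : R := N.+1%:R^-1 / 2.
have e0 : 0 < e by rewrite divr_gt0.
have [h h0 hP] : exists2 h, 0 < h & forall i u v, 0 <= u <= t -> 0 <= v <= t ->
    `|u - v| < h -> `|X w u i - X w v i| < e.
  apply: near_right0_ex; apply: filter_forall => i.
  have [h h0 hP] := uniform_continuity_segment (@cX w i) t0 e0.
  near=> h' => u v ut vt uv; apply: hP => //; apply: lt_le_trans uv _.
  by near: h'; exact: nbhs_right_le.
have [M Mt] : exists M : nat, t / M.+1%:R < h.
  have th0 : 0 < h / (t + 1) by rewrite divr_gt0 // ltr_wpDl.
  have : \forall M \near \oo, M.+1%:R^-1 < h / (t + 1).
    exact: (near_infty_natSinv_lt (PosNum th0)).
  move=> /filter_ex[M hM]; exists M; move: hM; rewrite ltr_pdivlMr ?ltr_wpDl // => hM.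
  rewrite mulrC; apply: le_lt_trans hM; rewrite ler_wpM2l ?invr_ge0 //.
  by rewrite lerDl.
have M0 : 0 < M.+1%:R :> R by [].
have /choice[c cP] : forall k : nat, exists c : {ffun A -> rat}, forall i,
    `|X w (k%:R / M.+1%:R * t) i - ratr (c i)| < e.
  move=> k; have /choice[c cP] : forall i, exists r : rat,
      `|X w (k%:R / M.+1%:R * t) i - ratr r| < e.
    move=> i; have [r] : exists r : rat, ratr r \in
        `]X w (k%:R / M.+1%:R * t) i - e, X w (k%:R / M.+1%:R * t) i + e[.
      by apply/rat_in_itvoo; lra.
    by rewrite in_itv/= => /andP[? ?]; exists r; rewrite ltr_norml; apply/andP; split; lra.
  by exists (finfun c) => i; rewrite ffunE.
(* Truncation on a grid with [M.+1] cells yields the indices 0 to [M.+1], the last one at time 1;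
   hence [M.+2] values. *)
exists (M.+1, mkseq c M.+2) => -[r i] /= /andP[r0 r1].
have rR0 : 0 <= ratr r :> R by rewrite ler0q.
have rR1 : ratr r <= 1 :> R by rewrite -(ler_rat R) rmorph1 in r1.
rewrite /step /=; set k := Num.truncn _.
have /truncn_itv : 0 <= ratr r * M.+1%:R :> R by rewrite mulr_ge0.
rewrite -/k => /andP[k1 k2].
have kM : (k < M.+2)%N.
  rewrite ltnS -(ler_nat R) (le_trans k1) // -[leRHS]mul1r ler_wpM2r //.
rewrite nth_mkseq //.
have hk := cP k i.
have : `|X w (ratr r * t) i - X w (k%:R / M.+1%:R * t) i| < e.
  apply: hP.
  - by rewrite mulr_ge0 //= ler_piMl.
  - rewrite mulr_ge0 ?divr_ge0 //= ler_piMl // ler_pdivrMr // mul1r ler_nat.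
    by rewrite -ltnS.
  - have kr : k%:R / M.+1%:R <= ratr r :> R by rewrite ler_pdivrMr.
    rewrite -mulrBl ger0_norm ?mulr_ge0 ?subr_ge0 //.
    apply: le_lt_trans Mt; rewrite [leRHS]mulrC ler_wpM2r //.
    have kM1 : M.+1%:R^-1 + k%:R / M.+1%:R = k.+1%:R / M.+1%:R :> R.
      by rewrite -[k.+1%:R]natr1 mulrDl mul1r addrC.
    by rewrite lerBlDr kM1 ler_pdivlMr // ltW.
have -> : N.+1%:R^-1 = e + e by rewrite /e -splitr.
move: hk; rewrite !ltr_norml => /andP[? ?] /andP[? ?].
by rewrite ler_norml; apply/andP; split; lra.
Unshelve. all: by end_near. Qed.

(* [a <= phi w t i] holds iff for every [N] some tube of radius [1 / N.+1] around a
   rational step function contains [X w] and the input of a path with this property. *)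
Lemma ESM_measurable (t : R) (i : A) : 0 <= t ->
  measurable_fun setT (fun w => phi w t i).
Proof.
move=> t0; have [C C0 stab] := regulated_stability b_gt0 b_sum.
(* Inputs in a common tube are within twice its radius of each other, so stability bounds the
   distance of the solutions. *)
have near_tube N q w w' : tube t N q w -> tube t N q w' ->
    phi w' t i - C * (2 * N.+1%:R^-1) <= phi w t i.
  move=> tw tw'.
  have [eta esp] := ESM w; have [eta' esp'] := ESM w'.
  have rg := ESP_regulated b_gt0 b_sum (@cX w) esp.
  have rg' := ESP_regulated b_gt0 b_sum (@cX w') esp'.
  have [phiE eta0] := ESP_input esp; have [phiE' eta0'] := ESP_input esp'.
  have e0 : 0 < 2 * N.+1%:R^-1 :> R by rewrite mulr_gt0.
  have cl : inputs_close t (2 * N.+1%:R^-1) (phi w) eta (phi w') eta'.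
    split=> [j|u j ut]; first by rewrite eta0 eta0' subrr normr0 ltW.
    have u0 : 0 <= u by case/andP: ut.
    rewrite phiE // phiE' //.
    have cg : {within `[0, +oo[, continuous (fun u => X w u j - X w' u j)}.
      exact: (path_continuousB (@cX w) (@cX w')).
    apply: (le_on_rational_times cg t0) ut => r r01.
    have := tw (r, j) r01; have := tw' (r, j) r01.
    move: e0; move: (N.+1%:R^-1) => eN _.
    by rewrite /= !ler_norml => /andP[? ?] /andP[? ?]; apply/andP; split; lra.
  have := stab _ _ _ _ _ _ e0 rg rg' cl t i.
  rewrite t0 lexx => /(_ isT); move: (N.+1%:R^-1) => eN.
  by rewrite ler_norml => /andP[? ?]; lra.
apply: (measurability _ (RGenCInfty.measurableE R)) => _ [_ [a ->] <-].
rewrite setTI.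
(* Whether a tube is selected depends on its code and not on [w], so that every [F N q] is
   measurable. *)
pose F N (q : code) := if `[< exists w', tube t N q w' /\ a <= phi w' t i >]
  then tube t N q else set0.
suff -> : (fun w => phi w t i) @^-1` `[a, +oo[%classic = \bigcap_N \bigcup_q F N q.
  apply: bigcap_measurable => // N _; apply: countable_bigcupT_measurable => [|q].
    exact: countableP.
  by rewrite /F; case: asboolP => // _; exact: measurable_tube.
apply/seteqP; split => w /=; rewrite in_itv/= andbT.
  move=> aw N _; have [q qw] := tube_cover N w t0; exists q => //.
  by rewrite /F asboolT //; exists w.
move=> h; rewrite leNgt; apply/negP => wa.
pose e := (a - phi w t i) / (2 * C).
have e0 : 0 < e by rewrite divr_gt0 ?subr_gt0 // mulr_gt0.
have : \forall N \near \oo, N.+1%:R^-1 < e.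
  exact: (near_infty_natSinv_lt (PosNum e0)).
move=> /filter_ex[N Ne]; have [q _] := h N I.
rewrite /F; case: asboolP => // -[w' [tw' aw']] tw.
have := near_tube _ _ _ _ tw tw'.
move: Ne; rewrite /e ltr_pdivlMr ?mulr_gt0 //; move: (N.+1%:R^-1) => eN; lra.
Qed.

End measurable_regulation.

Section cadlag_operations.
Context {R : realType} {A : finType}.
Implicit Types (x y : R -> A -> R).

Lemma cadlag_ext x y : (forall t i, 0 <= t -> x t i = y t i) -> cadlag x -> cadlag y.
Proof.
move=> xy cx i; have [rx lx] := cx i; split=> t t0.
  rewrite -xy //; apply: cvg_trans (rx t t0); apply: near_eq_cvg; near=> s.
  by rewrite xy // (le_trans t0) //; near: s; exact: nbhs_right_ge.
have /cvg_ex[l xl] := lx t t0; apply/cvg_ex; exists l.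
apply: cvg_trans xl; apply: near_eq_cvg; near=> s.
by rewrite xy //; near: s; exact: nbhs_left_ge.
Unshelve. all: by end_near. Qed.

Lemma cadlagD x y : cadlag x -> cadlag y -> cadlag (fun t i => x t i + y t i).
Proof.
move=> cx cy i; have [rx lx] := cx i; have [ry ly] := cy i.
split=> t t0; first by apply: cvgD; [exact: rx|exact: ry].
have /cvg_ex[l xl] := lx t t0; have /cvg_ex[m ym] := ly t t0.
by apply/cvg_ex; exists (l + m); exact: cvgD.
Qed.

Lemma cadlagZ (c : R) x : cadlag x -> cadlag (fun t i => c * x t i).
Proof.
move=> cx i; have [rx lx] := cx i.
split=> t t0; first by apply: cvgM; [exact: cvg_cst|exact: rx].
have /cvg_ex[l xl] := lx t t0.
by apply/cvg_ex; exists (c * l); apply: cvgM => //; exact: cvg_cst.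
Qed.

Lemma cadlagB x y : cadlag x -> cadlag y -> cadlag (fun t i => x t i - y t i).
Proof.
move=> cx cy; have := cadlagD cx (cadlagZ (-1) cy).
by apply: cadlag_ext => t i _; rewrite mulN1r.
Qed.

Lemma cadlag_linear (u v : A -> R) : cadlag (fun t i => u i + v i * t).
Proof.
apply: path_continuous_cadlag => i; apply: continuous_subspaceT => t.
by apply: cvgD; [exact: cvg_cst|apply: cvgM; [exact: cvg_cst|exact: cvg_id]].
Qed.

Lemma cadlag_time_change (a : R) x : 0 < a -> cadlag x -> cadlag (fun t => x (a * t)).
Proof.
move=> a0 cx i; have [rx lx] := cx i; split=> t t0.
  have at0 : 0 <= a * t by rewrite mulr_ge0 // ltW.
  apply: cvg_comp (rx _ at0) => B [/= e e0 eB].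
  exists (e / a); first by rewrite /= divr_gt0.
  move=> s /=; rewrite ltr_pdivlMr // => ts st; apply: eB; last by rewrite ltr_pM2l.
  by rewrite /= -mulrBr normrM gtr0_norm // mulrC.
have at0 : 0 < a * t by rewrite mulr_gt0.
have /cvg_ex[l xl] := lx _ at0; apply/cvg_ex; exists l.
apply: cvg_comp xl => B [/= e e0 eB].
exists (e / a); first by rewrite /= divr_gt0.
move=> s /=; rewrite ltr_pdivlMr // => ts st; apply: eB; last by rewrite ltr_pM2l.
by rewrite /= -mulrBr normrM gtr0_norm // mulrC.
Qed.

Lemma cadlag_diffusion_scaled (n : nat) x y :
  cadlag x -> cadlag y -> cadlag (diffusion_scaled n x y).
Proof.
(* For [n = 0] the time change is degenerate, but the factor [sqrt 0] makes the scaled path zero. *)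
move=> cx cy; have [->|n0] := posnP n.
  have := cadlag_linear (fun=> 0) (fun=> 0).
  by apply: cadlag_ext => t i _; rewrite /diffusion_scaled sqrtr0 !mul0r addr0.
have n0R : 0 < n%:R :> R by rewrite ltr0n.
have := cadlagZ (Num.sqrt n%:R) (cadlagB (cadlagZ (n%:R^-1) (cadlag_time_change n0R cx)) cy).
by apply: cadlag_ext => t i _; rewrite /diffusion_scaled /fluid_scaled mulrC [_^-1 * _]mulrC mulrC.
Qed.

Lemma extend0_cadlag {J : nat} (S : {set 'I_J}) (x : R -> critical S -> R) :
  cadlag x -> cadlag (extend0 x).
Proof.
move=> cx i; rewrite /extend0; case: insubP => [k _ _|_] /=; first exact: cx.
by split=> t t0; [exact: cvg_cst|exact: is_cvg_cst].
Qed.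

End cadlag_operations.

Section scaled_process.
Context {R : realType} {J : nat} {d : measure_display} {T : measurableType d}.

Lemma cadlag_process_diffusion_scaled (n : nat) (X : T -> R -> 'I_J -> R)
    (xbar : R -> 'I_J -> R) :
  cadlag_process X -> cadlag xbar ->
  cadlag_process (fun w => diffusion_scaled n (X w) xbar).
Proof.
move=> [cX mX] cx; split=> [w|t i t0]; first exact: cadlag_diffusion_scaled.
apply: measurable_funM => //; apply: measurable_funB => //.
by apply: measurable_funM => //; apply: mX; rewrite mulr_ge0.
Qed.

Variables (alpha beta : 'I_J -> R) (U0 : 'I_J -> R) (H U : R -> 'I_J -> R).
Hypothesis wU : gps_workload alpha beta U0 H U.

Lemma busy_timeE t i : 0 <= t -> busy_time alpha beta U t i = U0 i + H t i - U t i.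
Proof. by move=> /wU[_ /(_ i) UE]; rewrite [in RHS]UE; ring. Qed.

End scaled_process.

Lemma sqrt_nat_cvgy {R : realType} : (Num.sqrt n%:R : R) @[n --> \oo] --> +oo.
Proof.
apply/cvgryPge => M; near=> n.
rewrite (le_trans (ler_norm M)) // -sqrtr_sqr ler_wsqrtr //.
by near: n; exact: nbhs_infty_ger.
Unshelve. all: by end_near. Qed.

(** * Pathwise limit of the diffusion scaled workload *)

Section workload_limit.
Context {R : realType} {J : nat}.
Variables (alpha beta gamma : 'I_J -> R) (S : {set 'I_J}).
Hypotheses (alpha_ge0 : forall i, 0 <= alpha i)
  (beta_gt0 : forall i, 0 < beta i) (beta_sum : \sum_i beta i = 1).
Variables (C : R) (kappa : 'I_J -> R).
Hypotheses (S_proper : S != [set: 'I_J]%SET)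
  (kappa_ge0 : forall j, 0 <= kappa j)
  (kappaS : forall j, (0 < kappa j) = (j \in S))
  (nuE : forall j, gamma j - alpha j = beta j * (C - kappa j))
  (nu_sum : \sum_j (gamma j - alpha j) = 0).
Variables (H U : nat -> R -> 'I_J -> R) (gamma_ : nat -> 'I_J -> R)
  (uhat chat : 'I_J -> R) (B : R -> 'I_J -> R) (UK : R -> critical S -> R)
  (Ubar : R -> 'I_J -> R).
Hypotheses (H_arrival : forall n, arrival_path (H n))
  (U_cadlag : forall n, cadlag (U n))
  (U_workload : forall n, gps_workload alpha beta (U n 0) (H n) (U n))
  (U0_clt : forall i, U n 0 i / Num.sqrt n%:R @[n --> \oo] --> uhat i)
  (uhat_S : forall i, i \in S -> uhat i = 0)
  (B_continuous : path_continuous B) (B0 : forall i, B 0 i = 0)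
  (H_clt : uoc_cvg
     (fun n => diffusion_scaled n (H n) (linear_path (fun=> 0) (gamma_ n))) B)
  (gamma_clt : forall i,
     Num.sqrt n%:R * (gamma_ n i - gamma i) @[n --> \oo] --> chat i)
  (Ubar0 : forall (t : R) i, 0 <= t -> Ubar t i = 0)
  (UK_ESM : gps_ESM (critical_weight (S := S) beta)
     (critical_input beta uhat chat B) UK).

(** The limit of the scaled workload input once the diverging drift [sqrt n * (gamma - alpha) * t]
    is removed. *)
Definition netput (t : R) (i : 'I_J) : R := uhat i + B t i + chat i * t.

Lemma netput_continuous : path_continuous netput.
Proof.
move=> i t; apply: cvgD; last first.
  by apply: continuous_subspaceT => s; apply: cvgM; [exact: cvg_cst|exact: cvg_id].
by apply: cvgD; [exact: cvg_cst|exact: B_continuous].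
Qed.

Lemma critical_inputE t (k : critical S) : critical_input beta uhat chat B t k =
  netput t (val k) + critical_weight beta k * \sum_(j in S) netput t j.
Proof.
rewrite /critical_input /netput; congr (_ + _ * _).
by apply: eq_bigr => j jS; rewrite uhat_S // add0r.
Qed.

Lemma critical_input_continuous :
  path_continuous (critical_input (S := S) beta uhat chat B).
Proof.
suff : path_continuous (fun t (k : critical S) =>
    netput t (val k) + critical_weight beta k * \sum_(j in S) netput t j).
  by apply: path_continuous_ext => t k _; rewrite critical_inputE.
move=> k t; apply: cvgD; first exact: netput_continuous.
apply: cvgM; first exact: cvg_cst.
by apply: cvg_big => [|j _]; [exact: add_continuous|exact: netput_continuous].
Qed.

Lemma sqrt_div (n : nat) : (0 < n)%N -> Num.sqrt n%:R / n%:R = (Num.sqrt n%:R)^-1 :> R.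
Proof.
move=> n0; have s0 : Num.sqrt n%:R != 0 :> R by rewrite gt_eqF // sqrtr_gt0 ltr0n.
by rewrite -{2}[n%:R]sqr_sqrtr ?ler0n // expr2 invfM mulrA divff // mul1r.
Qed.

Lemma netput_clt (T e : R) : 0 <= T -> 0 < e ->
  \forall n \near \oo, forall t i, 0 <= t <= T ->
  `|U n 0 i / Num.sqrt n%:R +
    diffusion_scaled n (H n) (linear_path (fun=> 0) (gamma_ n)) t i +
    Num.sqrt n%:R * (gamma_ n i - gamma i) * t - netput t i| <= e.
Proof.
move=> T0 e0.
have e3 : 0 < e / 3 by rewrite divr_gt0.
(* The rate error is multiplied by a time up to [T], and [T] may be zero; hence the divisor
   [T + 1]. *)
have eT : 0 < e / 3 / (T + 1) by rewrite divr_gt0 // ltr_wpDl.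
have /uoc_cvgP/(_ _ _ T0 e3) H3 := H_clt.
have U3 : \forall n \near \oo, forall i, `|uhat i - U n 0 i / Num.sqrt n%:R| < e / 3.
  by apply: filter_forall => i; have /cvgrPdist_lt/(_ _ e3) := @U0_clt i.
have g3 : \forall n \near \oo, forall i,
    `|chat i - Num.sqrt n%:R * (gamma_ n i - gamma i)| < e / 3 / (T + 1).
  by apply: filter_forall => i; have /cvgrPdist_lt/(_ _ eT) := @gamma_clt i.
near=> n; move=> t i /andP[t0 tT].
have hU : forall i, `|uhat i - U n 0 i / Num.sqrt n%:R| < e / 3 by near: n.
have hg : forall i, `|chat i - Num.sqrt n%:R * (gamma_ n i - gamma i)| < e / 3 / (T + 1).
  by near: n.
have hH : forall t i, 0 <= t <= T ->
    `|diffusion_scaled n (H n) (linear_path (fun=> 0) (gamma_ n)) t i - B t i| <= e / 3.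
  by near: n.
have := hH t i; rewrite t0 tT => /(_ isT); have := hU i.
have : `|(chat i - Num.sqrt n%:R * (gamma_ n i - gamma i)) * t| <= e / 3.
  rewrite normrM (ger0_norm t0).
  rewrite (@le_trans _ _ (e / 3 / (T + 1) * (T + 1))) //; last first.
    by rewrite divfK // gt_eqF // ltr_wpDl.
  by apply: ler_pM => //; [exact: ltW|rewrite (le_trans tT) // lerDl].
rewrite mulrBl /netput !ler_norml ltr_norml => /andP[? ?] /andP[? ?] /andP[? ?].
by apply/andP; split; lra.
Unshelve. all: by end_near. Qed.

(** As the fluid limit vanishes, the diffusion scaled workload is the rescaled workload itself. It
    is regulated by the rescaled redistributed service, and [netput_clt] identifies the limit of its
    input apart from the drift, so the collapse applies with [q n = sqrt n]. *)
Lemma workload_cvg :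
  uoc_cvg (fun n => diffusion_scaled n (U n) Ubar) (extend0 UK).
Proof.
apply/uoc_cvgP.
pose c n : R := Num.sqrt n%:R / n%:R.
pose phi n t i := c n * U n (n%:R * t) i.
pose eta n t i := c n * redistributed_service alpha beta (U n) (n%:R * t) i.
have cvg := @workload_collapse R J S beta beta_gt0 beta_sum S_proper C
  (fun i => gamma i - alpha i) kappa kappa_ge0 kappaS nuE nu_sum
  (critical_input beta uhat chat B) UK netput phi eta (fun n => Num.sqrt n%:R)
  netput_continuous critical_input_continuous critical_inputE.
move=> T e T0 e0.
have : \forall n \near \oo, forall t i, 0 <= t <= T ->
    `|phi n t i - extend0 UK t i| <= e.
  apply: cvg => //.
  - by move=> j jS; rewrite /netput uhat_S // B0 mulr0 !addr0.
  - near=> n.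
    have n0 : (0 < n)%N by near: n; exact: nbhs_infty_gt.
    have n0R : 0 < n%:R :> R by rewrite ltr0n.
    split.
      apply: regulated_scale => //; first by rewrite divr_gt0 // sqrtr_gt0.
      exact: (workload_regulated alpha_ge0 beta_gt0 (U_cadlag n) (U_workload n)).
    move=> i; rewrite /eta mulr0 (redistributed_serviceE (U_workload n)) //.
    have [_ _ _ _ ->] := H_arrival n.
    by rewrite subrr sub0r oppr0 mulr0 addr0 mulr0.
  - exact: sqrt_nat_cvgy.
  - move=> T' e' T'0 e'0; have := netput_clt T'0 e'0.
    move=> h; near=> n.
    have n0 : (0 < n)%N by near: n; exact: nbhs_infty_gt.
    have n0R : n%:R != 0 :> R by rewrite pnatr_eq0 -lt0n.
    have hn : forall t i, 0 <= t <= T' -> `|U n 0 i / Num.sqrt n%:R +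
      diffusion_scaled n (H n) (linear_path (fun=> 0) (gamma_ n)) t i +
      Num.sqrt n%:R * (gamma_ n i - gamma i) * t - netput t i| <= e'.
      by near: n; exact: h.
    move=> t i tT; have := hn t i tT; congr (`|_ - _| <= _).
    have nt0 : 0 <= n%:R * t by case/andP: tT => t0 _; rewrite mulr_ge0.
    rewrite /phi /eta (redistributed_serviceE (U_workload n)) //.
    rewrite -sqrt_div // /diffusion_scaled /fluid_scaled /linear_path /c.
    by field.
apply: filterS => n h t i tT; have := h t i tT; congr (`|_ - _| <= _).
rewrite /phi /c /diffusion_scaled /fluid_scaled Ubar0 ?subr0; first by ring.
by case/andP: tT.
Unshelve. all: by end_near. Qed.

End workload_limit.

Theorem theorem5p7
  (R : realType) (J : nat) (J_gt1 : (1 < J)%N)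
  (alpha beta : 'I_J -> R)
  (alpha_itv : forall i, 0 <= alpha i <= 1) (alpha_sum : \sum_i alpha i = 1)
  (beta_itv : forall i, 0 < beta i < 1) (beta_sum : \sum_i beta i = 1)
  (d : measure_display) (T : measurableType d) (P : probability T R)
  (H U : nat -> T -> R -> 'I_J -> R)
  (* (A) *)
  (H_process : forall n, cadlag_process (H n))
  (H_arrival : forall n w, arrival_path (H n w))
  (H_jumps : forall n, {ae P, forall w, locally_finite_jumps (H n w)})
  (U_process : forall n, cadlag_process (U n))
  (U0_ge0 : forall n w, nonneg_vec (U n w 0))
  (U_workload : forall n w,
     gps_workload alpha beta (U n w 0) (H n w) (U n w))
  (* (B) *)
  (ubar : 'I_J -> R) (ubar_ge0 : nonneg_vec ubar)
  (U0_lln : {ae P, forall w, forall i,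
     U n w 0 i / n%:R @[n --> \oo] --> ubar i})
  (gamma_ : nat -> 'I_J -> R) (gamma_ge0_ : forall n, nonneg_vec (gamma_ n))
  (H_lln : forall n, {ae P, forall w,
     uoc_cvg (fun m => fluid_scaled m (H n w))
             (linear_path (fun=> 0) (gamma_ n))})
  (gamma : 'I_J -> R) (gamma_ge0 : nonneg_vec gamma)
  (gamma_lim : forall i, gamma_ n i @[n --> \oo] --> gamma i)
  (* (C) *)
  (S : {set 'I_J})
  (S_nu : strictly_subcritical beta (fun i => gamma i - alpha i) S)
  (uhat : T -> 'I_J -> R)
  (uhat_meas : forall i, measurable_fun setT (fun w => uhat w i))
  (uhat_manifold : forall w, invariant_manifold S (uhat w))
  (U0_clt : {ae P, forall w, forall i,
     U n w 0 i / Num.sqrt n%:R @[n --> \oo] --> uhat w i})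
  (MH : 'M[R]_J) (B : T -> R -> 'I_J -> R) (B_BM : brownian_motion P MH B)
  (H_clt : weak_cvg P
     (fun n w => diffusion_scaled n (H n w) (linear_path (fun=> 0) (gamma_ n)))
     B)
  (H_clt_as : {ae P, forall w, uoc_cvg
     (fun n => diffusion_scaled n (H n w) (linear_path (fun=> 0) (gamma_ n)))
     (B w)})
  (chat : 'I_J -> R)
  (gamma_clt : forall i,
     Num.sqrt n%:R * (gamma_ n i - gamma i) @[n --> \oo] --> chat i)
  (* (D) *)
  (heavy_traffic : \sum_i gamma i = 1)
  (* fluid limits *)
  (Ubar : R -> 'I_J -> R)
  (Ubar_SM : gps_SM beta (linear_path ubar (fun i => gamma i - alpha i)) Ubar)
  (* diffusion limits *)
  (UK : T -> R -> critical S -> R)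
  (UK_ESM : forall w, gps_ESM (critical_weight (S := S) beta)
     (critical_input beta (uhat w) chat (B w)) (UK w)) :
  let Tbar : R -> 'I_J -> R := fun t i => gamma i * t + ubar i - Ubar t i in
  let Uhat : T -> R -> 'I_J -> R := fun w => extend0 (UK w) in
  let That : T -> R -> 'I_J -> R := fun w t i =>
    uhat w i + B w t i - Uhat w t i + chat i * t in
  weak_cvg P (fun n w => diffusion_scaled n (U n w) Ubar) Uhat /\
  weak_cvg P (fun n w =>
    diffusion_scaled n (busy_time alpha beta (U n w)) Tbar) That.
Proof.
move=> Tbar Uhat That.
have alpha_ge0 i : 0 <= alpha i by case/andP: (alpha_itv i).
have beta_gt0 i : 0 < beta i by case/andP: (beta_itv i).
have nu_sum : \sum_i (gamma i - alpha i) = 0.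
  by rewrite sumrB heavy_traffic alpha_sum subrr.
have [|C [kappa [kappa_ge0 kappaS nuE S_proper]]] :=
  strictly_subcritical_rates beta_gt0 beta_sum _ nu_sum S_nu.
  by rewrite card_ord.
(* [U n w 0 i / n] is [U n w 0 i / sqrt n] divided by [sqrt n], so it tends to zero. Since [ubar] is
   deterministic, a single outcome in the almost sure set suffices. *)
have ubar0 i : ubar i = 0.
  have Pproper : ProperFilter (almost_everywhere P).
    by apply: ae_properfilter_algebraOfSetsType; rewrite [X in (0 < X)%E](@probability_setT _ _ _ P).
  have [w [lln clt]] : exists w,
      (forall i, U n w 0 i / n%:R @[n --> \oo] --> ubar i) /\
      (forall i, U n w 0 i / Num.sqrt n%:R @[n --> \oo] --> uhat w i).
    exact: (@filter_ex _ _ Pproper _ (filterI U0_lln U0_clt)).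
  have sqrt0 : (Num.sqrt n%:R)^-1 @[n --> \oo] --> (0 : R).
    apply/gtr0_cvgV0; last exact: sqrt_nat_cvgy.
    by near=> n; rewrite sqrtr_gt0 ltr0n; near: n; exact: nbhs_infty_gt.
  have : U n w 0 i / n%:R @[n --> \oo] --> uhat w i * 0.
    have <- : (fun n => U n w 0 i / Num.sqrt n%:R * (Num.sqrt n%:R)^-1) =
        (fun n => U n w 0 i / n%:R).
      by apply/funext => n; rewrite -mulrA -invfM -expr2 sqr_sqrtr.
    exact: cvgM (clt i) sqrt0.
  by rewrite mulr0 => un0; rewrite -(cvg_lim _ (lln i)) // (cvg_lim _ un0).
have ubarE : ubar = fun=> 0 by apply/funext.
have Ubar0 (t : R) i : 0 <= t -> Ubar t i = 0.
  by move=> t0; apply: (SM_balanced_linear beta_gt0 beta_sum nu_sum) => //; rewrite -ubarE.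
have [_ B_meas B_cont _ _] := B_BM.
have B0 w i : B w 0 i = 0 by have [] := B_cont w i.
have B_continuous w : path_continuous (B w) by move=> i; have [] := B_cont w i.
have uhat_S w i : i \in S -> uhat w i = 0.
  by move=> iS; have [_] := uhat_manifold w; apply.
have UK_cadlag w : cadlag (UK w) by have [eta []] := UK_ESM w.
have UK_meas t k : 0 <= t -> measurable_fun setT (fun w => UK w t k).
  move=> t0.
  apply: (ESM_measurable (critical_weight_gt0 beta_gt0 S_proper)
    (critical_weight_sum beta_gt0 S_proper) _ _ UK_ESM) => // [w|u l u0].
    exact: critical_input_continuous (uhat_S w) (B_continuous w).
  rewrite /critical_input; apply: measurable_funD; last first.
    apply: measurable_funM => //.
    under eq_fun do rewrite -big_enum.
    apply: measurable_sum => j; apply: measurable_funD => //; exact: B_meas.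
  apply: measurable_funD => //; apply: measurable_funD => //; exact: B_meas.
have Uhat_process : cadlag_process Uhat.
  split=> [w|t i t0]; first exact: extend0_cadlag.
  rewrite /Uhat /extend0; case: insubP => [k _ _|_] //=; exact: UK_meas.
have Ubar_cadlag : cadlag Ubar by have [eta []] := Ubar_SM.
(* The collapse is applied outcome by outcome, wherever the initial workloads and the arrivals
   converge. *)
have Un_cvg : {ae P, forall w, uoc_cvg (fun n => diffusion_scaled n (U n w) Ubar) (Uhat w)}.
  move: U0_clt H_clt_as; apply: filterS2 => w U0w Hw.
  exact: (workload_cvg alpha_ge0 beta_gt0 beta_sum S_proper kappa_ge0 kappaS nuE nu_sum
    (H_arrival ^~ w) (fun n => (U_process n).1 w) (U_workload ^~ w) U0w
    (uhat_S w) (B_continuous w) (B0 w) Hw gamma_clt Ubar0 (UK_ESM w)).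
split.
  apply: ae_uoc_weak_cvg => // n.
  exact: cadlag_process_diffusion_scaled (U_process n) Ubar_cadlag.
have busyE n w t i : 0 <= t ->
    busy_time alpha beta (U n w) t i = U n w 0 i + H n w t i - U n w t i.
  by move=> t0; exact: (busy_timeE (U_workload n w)).
have busy_process n : cadlag_process (fun w => busy_time alpha beta (U n w)).
  have [cU mU] := U_process n; have [cH mH] := H_process n.
  split=> [w|t i t0].
    have := cadlagB (cadlagD (cadlag_linear (U n w 0) (fun=> 0)) (cH w)) (cU w).
    by apply: cadlag_ext => t i t0; rewrite busyE // mul0r addr0.
  apply: (@eq_measurable_fun _ _ _ _ _ (fun w => U n w 0 i + H n w t i - U n w t i)).
    by move=> w _; rewrite busyE.
  by apply: measurable_funB; [apply: measurable_funD; [exact: mU|exact: mH]|exact: mU].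
apply: ae_uoc_weak_cvg => [n||].
- apply: cadlag_process_diffusion_scaled => //.
  have := cadlagB (cadlag_linear ubar gamma) Ubar_cadlag.
  by apply: cadlag_ext => t i _; rewrite /Tbar addrC [_ + gamma i * t]addrC; ring.
- have [cU mU] := Uhat_process; split=> [w|t i t0].
    have := cadlagB (cadlagD (cadlag_linear (uhat w) chat)
      (path_continuous_cadlag (B_continuous w))) (cU w).
    by apply: cadlag_ext => t i _; rewrite /That; ring.
  apply: measurable_funD => //; apply: measurable_funB; last exact: mU.
  by apply: measurable_funD => //; exact: B_meas.
- move: Un_cvg U0_clt H_clt_as; apply: filterS3 => w /uoc_cvgP Uw U0w Hw.
  apply/uoc_cvgP => T' e T0 e0.
  have e2 : 0 < e / 2 by rewrite divr_gt0.
  have U2 := Uw _ _ T0 e2.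
  (* The scaled busy time is exactly the scaled netput of [netput_clt] minus the scaled workload,
     and [That] is [netput] minus [Uhat]; each difference receives [e / 2]. *)
  have D2 := @netput_clt R J gamma (H ^~ w) (U ^~ w) gamma_ (uhat w) chat (B w) U0w Hw gamma_clt _ _ T0 e2.
  near=> n; move=> t i tT.
  have n0 : (0 < n)%N by near: n; exact: nbhs_infty_gt.
  have n0R : n%:R != 0 :> R by rewrite pnatr_eq0 -lt0n.
  have t0 : 0 <= t by case/andP: tT.
  have nt0 : 0 <= n%:R * t by rewrite mulr_ge0.
  have hU : forall t i, 0 <= t <= T' ->
      `|diffusion_scaled n (U n w) Ubar t i - Uhat w t i| <= e / 2.
    by near: n; exact: U2.
  have hD : forall t i, 0 <= t <= T' -> `|U n w 0 i / Num.sqrt n%:R +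
      diffusion_scaled n (H n w) (linear_path (fun=> 0) (gamma_ n)) t i +
      Num.sqrt n%:R * (gamma_ n i - gamma i) * t - netput (uhat w) chat (B w) t i| <= e / 2.
    by near: n; exact: D2.
  rewrite (splitr e); apply: le_trans (lerD (hD t i tT) (hU t i tT)).
  apply: le_trans (ler_normB _ _); rewrite le_eqVlt; apply/orP; left; apply/eqP.
  congr (`|_|); rewrite -sqrt_div // /diffusion_scaled /fluid_scaled busyE //.
  rewrite /linear_path /netput /That /Tbar ubar0 Ubar0 //.
  by field.
Unshelve. all: by end_near. Qed.
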